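(* Let $k$ be an $F$-finite field of characteristic $p>0$, and let $R$ be a strongly $F$-regular $k$-algebra, essentially of finite type over $k$, such that the second diagonal Cartier algebra $\mathscr D^{(2)}(R/k)$ is $F$-split. Let $\mathfrak p\subseteq R$ be a prime ideal, and let $h$ be the height of $\mathfrak p$. Then $$\mathfrak p^{(N)}\subseteq \mathfrak p^{(\lceil Ns\rceil-h)}\;\mathfrak p^{(\lceil N(1-s)\rceil-h)}$$ for all integers $N>2h$ and all real $s\in\left(\frac hN,\,1-\frac hN\right)$. Further, $$\mathfrak p^{(2hn)}\subseteq\mathfrak p^n$$ for all integers $n\ge1$.
   Context: All rings are commutative. For a ring $R$ of prime characteristic $p$ and $e\ge 0$, $F^e_*$ denotes restriction of scalars along the $e$-th iterate of Frobenius $F^e\colon R\to R$, $x\mapsto x^{p^e}$: for an $R$-module $M$, $F^e_*M=\{F^e_*m : m\in M\}$ with $F^e_*m+F^e_*n=F^e_*(m+n)$ and $rF^e_*m=F^e_*(r^{p^e}m)$. $R$ is $F$-finite if $F^e_*R$ is a finitely generated $R$-module for some (equivalently all) $e>0$. An $F$-splitting of $R$ is an $R$-linear map $F^e_*R\to R$ (with $e>0$) sending $F^e_*1$ to $1$. Let $R$ be $F$-finite, reduced and Noetherian of characteristic $p$, and let $R^\circ$ be the set of elements of $R$ not in any minimal prime. $R$ is strongly $F$-regular if for every $d\in R^\circ$ there exist $e>0$ and $\varphi\in\operatorname{Hom}_R(F^e_*R,R)$ with $\varphi(F^e_*d)=1$. Diagonal Cartier algebra: let $\mu\colon R\otimes_kR\to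 R$, $\mu(x\otimes y)=xy$. The degree-$e$ piece $\mathscr D^{(2)}_e(R/k)$ of $\mathscr D^{(2)}(R/k)=\bigoplus_e\mathscr D^{(2)}_e(R/k)$ is the set of all $\psi\in\operatorname{Hom}_R(F^e_*R,R)$ that have a lift to $R\otimes_kR$, i.e. for which there is an $(R\otimes_kR)$-linear map $\widehat\psi\colon F^e_*(R\otimes_kR)\to R\otimes_kR$ with $\mu\circ\widehat\psi=\psi\circ F^e_*\mu$. $\mathscr D^{(2)}(R/k)$ is $F$-split if $\mathscr D^{(2)}_e(R/k)$ contains an $F$-splitting of $R$ for some $e>0$. For a prime ideal $\mathfrak p$ of $R$, the $n$-th symbolic power is $\mathfrak p^{(n)}=\mathfrak p^nR_{\mathfrak p}\cap R$ (the preimage of $\mathfrak p^nR_{\mathfrak p}$ under $R\to R_{\mathfrak p}$).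
   Formalization: The final containment p^(2hn) ⊆ p^n is stated only for height h ≥ 1; for h = 0 it is false, since p^(0) = R is never contained in the proper ideal p^n (e.g. R = k, p = 0, n = 1). *)

(* Defs.v *)
From HB Require Import structures.
From mathcomp Require Import all_boot all_order all_algebra ring_quotient.
From mathcomp Require Import boolp classical_sets reals.
From mathcomp Require Import ring.

Set Implicit Arguments.
Unset Strict Implicit.
Unset Printing Implicit Defensive.

Import GRing.Theory.

Local Open Scope classical_set_scope.
Local Open Scope quotient_scope.
Local Open Scope ring_scope.

Section Ideals.
Variable R : comPzRingType.
Implicit Types (I J : set R) (n : nat).

(* The unit ideal is allowed, unlike in [idealr_closed]. *)
Definition ideal I : Prop :=
  I 0 /\ forall a x y, I x -> I y -> I (a * x + y).

Definition ideal_gen (A : set R) : set R := smallest ideal A.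

Definition ideal_mul I J : set R := ideal_gen [set x * y | x in I & y in J].

Definition ideal_pow I n : set R := iter n (ideal_mul I) setT.

Definition noetherian : Prop :=
  forall I, ideal I -> exists s : seq R, I = ideal_gen [set` s].

Definition reduced : Prop := forall (x : R) n, x ^+ n = 0 -> x = 0.

End Ideals.

(* Primes are the boolean predicates of [prime_idealr R]; with the classical
   axioms of boolp, these are all the prime ideals of [R]. *)

Section Primes.
Variable R : comNzRingType.
Implicit Types P Q : prime_idealr R.

Definition minimal_prime P : Prop :=
  forall Q, [set` Q] `<=` [set` P] -> [set` Q] = [set` P].

Definition outside_minimal_primes : set R :=
  [set d | forall P, minimal_prime P -> d \notin P].

Definition prime_chain P (n : nat) (c : nat -> prime_idealr R) : Prop :=
  (forall i, (i < n)%N -> [set` c i] `<` [set` c i.+1]) /\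
  [set` c n] = [set` P].

Definition has_height P (h : nat) : Prop :=
  (exists c, prime_chain P h c) /\
  (forall n c, prime_chain P n c -> (n <= h)%N).

End Primes.

Section Localization.
Variables (R : comPzRingType) (W : mulrClosed R).

Local Notation denom := {w : R | w \in W}.
Local Notation pre := (R * denom)%type.

Definition loc_rel (a b : pre) : bool :=
  `[< exists2 u, u \in W & u * (a.1 * sval b.2) = u * (b.1 * sval a.2) >].

Lemma loc_rel_refl : reflexive loc_rel.
Proof. by move=> a; apply/asboolP; exists 1; rewrite ?rpred1. Qed.

Lemma loc_rel_sym : symmetric loc_rel.
Proof. by move=> a b; apply/asboolP/asboolP => -[u uW e]; exists u. Qed.

Lemma loc_rel_trans : transitive loc_rel.
Proof.
move=> [b w] [a v] [c z] /asboolP[/= s sW e1] /asboolP[/= t tW e2].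
apply/asboolP; exists (s * t * sval w); first by rewrite !rpredM ?(svalP w).
rewrite [LHS](_ : _ = t * sval z * (s * (a * sval w))) /=; last by ring.
rewrite e1 [LHS](_ : _ = s * sval v * (t * (b * sval z))); last by ring.
by rewrite e2; ring.
Qed.

Canonical loc_equiv := EquivRel loc_rel loc_rel_refl loc_rel_sym loc_rel_trans.

Definition loc := {eq_quot loc_equiv}.

HB.instance Definition _ := Choice.on loc.
HB.instance Definition _ := EqQuotient.on loc.

Definition denom1 : denom := exist _ 1 (rpred1 W).
Definition denomM (v w : denom) : denom :=
  exist _ (sval v * sval w) (rpredM (svalP v) (svalP w)).

Definition frac (x : R) (w : denom) : loc := \pi_loc (x, w).

Lemma fracP (a : loc) : exists x w, a = frac x w.
Proof. by elim/quotW: a => -[x w]; exists x, w. Qed.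

Lemma frac_eqP x v y w :
  frac x v = frac y w <->
  exists2 u, u \in W & u * (x * sval w) = u * (y * sval v).
Proof.
split=> [/eqP|h]; first by rewrite eqmodE => /asboolP.
by apply/eqP; rewrite eqmodE; apply/asboolP.
Qed.

Lemma frac_eq x v y w : x * sval w = y * sval v -> frac x v = frac y w.
Proof. by move=> e; apply/frac_eqP; exists 1; rewrite ?rpred1 ?mul1r. Qed.

Definition loc_add (a b : loc) : loc :=
  let a' := repr a in let b' := repr b in
  frac (a'.1 * sval b'.2 + b'.1 * sval a'.2) (denomM a'.2 b'.2).
Definition loc_opp (a : loc) : loc :=
  let a' := repr a in frac (- a'.1) a'.2.
Definition loc_mul (a b : loc) : loc :=
  let a' := repr a in let b' := repr b in
  frac (a'.1 * b'.1) (denomM a'.2 b'.2).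

Lemma frac_repr x w : exists2 u, u \in W &
  u * ((repr (frac x w)).1 * sval w) = u * (x * sval (repr (frac x w)).2).
Proof. by apply/frac_eqP; rewrite /frac -surjective_pairing reprK. Qed.

Lemma loc_addE x v y w :
  loc_add (frac x v) (frac y w) = frac (x * sval w + y * sval v) (denomM v w).
Proof.
have [s sW e1] := frac_repr x v; have [t tW e2] := frac_repr y w.
rewrite /loc_add; move: (repr (frac x v)) (repr (frac y w)) e1 e2 => [a a'] [b b'] /= e1 e2.
apply/frac_eqP; exists (s * t); rewrite ?rpredM //=.
transitivity (t * sval b' * sval w * (s * (a * sval v)) +
              s * sval a' * sval v * (t * (b * sval w))); first by ring.
by rewrite e1 e2; ring.
Qed.

Lemma loc_oppE x v : loc_opp (frac x v) = frac (- x) v.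
Proof.
have [s sW e1] := frac_repr x v.
rewrite /loc_opp; move: (repr _) e1 => [a a'] /= e1.
by apply/frac_eqP; exists s => //=; rewrite !mulNr !mulrN e1.
Qed.

Lemma loc_mulE x v y w :
  loc_mul (frac x v) (frac y w) = frac (x * y) (denomM v w).
Proof.
have [s sW e1] := frac_repr x v; have [t tW e2] := frac_repr y w.
rewrite /loc_mul; move: (repr (frac x v)) (repr (frac y w)) e1 e2 => [a a'] [b b'] /= e1 e2.
apply/frac_eqP; exists (s * t); rewrite ?rpredM //=.
transitivity ((s * (a * sval v)) * (t * (b * sval w))); first by ring.
by rewrite e1 e2; ring.
Qed.

Lemma loc_addA : associative loc_add.
Proof.
move=> a b c.
have [[x [u ->]] [y [v ->]] [z [w ->]]] := And3 (fracP a) (fracP b) (fracP c).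
by rewrite !loc_addE; apply: frac_eq => /=; ring.
Qed.

Lemma loc_addC : commutative loc_add.
Proof.
move=> a b; have [[x [u ->]] [y [v ->]]] := conj (fracP a) (fracP b).
by rewrite !loc_addE; apply: frac_eq => /=; ring.
Qed.

Lemma loc_add0 : left_id (frac 0 denom1) loc_add.
Proof.
move=> a; have [x [u ->]] := fracP a.
by rewrite loc_addE; apply: frac_eq => /=; ring.
Qed.

Lemma loc_addN : left_inverse (frac 0 denom1) loc_opp loc_add.
Proof.
move=> a; have [x [u ->]] := fracP a.
by rewrite loc_oppE loc_addE; apply: frac_eq => /=; ring.
Qed.

Lemma loc_mulA : associative loc_mul.
Proof.
move=> a b c.
have [[x [u ->]] [y [v ->]] [z [w ->]]] := And3 (fracP a) (fracP b) (fracP c).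
by rewrite !loc_mulE; apply: frac_eq => /=; ring.
Qed.

Lemma loc_mulC : commutative loc_mul.
Proof.
move=> a b; have [[x [u ->]] [y [v ->]]] := conj (fracP a) (fracP b).
by rewrite !loc_mulE; apply: frac_eq => /=; ring.
Qed.

Lemma loc_mul1 : left_id (frac 1 denom1) loc_mul.
Proof.
move=> a; have [x [u ->]] := fracP a.
by rewrite loc_mulE; apply: frac_eq => /=; ring.
Qed.

Lemma loc_mulDl : left_distributive loc_mul loc_add.
Proof.
move=> a b c.
have [[x [u ->]] [y [v ->]] [z [w ->]]] := And3 (fracP a) (fracP b) (fracP c).
by rewrite !(loc_addE, loc_mulE); apply: frac_eq => /=; ring.
Qed.

HB.instance Definition _ :=
  GRing.isZmodule.Build loc loc_addA loc_addC loc_add0 loc_addN.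
HB.instance Definition _ :=
  GRing.Zmodule_isComPzRing.Build loc loc_mulA loc_mulC loc_mul1 loc_mulDl.

Definition to_loc (x : R) : loc := frac x denom1.

Lemma to_loc_zmod : zmod_morphism to_loc.
Proof.
move=> x y; rewrite [RHS](_ : _ = loc_add (to_loc x) (loc_opp (to_loc y))) //.
by rewrite loc_oppE loc_addE; apply: frac_eq => /=; ring.
Qed.

Lemma to_loc_monoid : monoid_morphism to_loc.
Proof.
split=> // x y; rewrite [RHS](_ : _ = loc_mul (to_loc x) (to_loc y)) //.
by rewrite loc_mulE; apply: frac_eq => /=; ring.
Qed.

HB.instance Definition _ := GRing.isZmodMorphism.Build R loc to_loc to_loc_zmod.
HB.instance Definition _ := GRing.isMonoidMorphism.Build R loc to_loc to_loc_monoid.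

End Localization.

Section SymbolicPower.
Variables (R : comNzRingType) (P : prime_idealr R).

Definition prime_compl : {pred R} := [predC P].

Lemma prime_compl_closed : mulr_closed prime_compl.
Proof.
split=> [|x y]; rewrite !inE ?idealr1 // => xP yP.
by rewrite prime_idealrM negb_or xP.
Qed.

HB.instance Definition _ :=
  GRing.isMulClosed.Build R prime_compl prime_compl_closed.

Definition symbolic_power (n : nat) : set R :=
  to_loc prime_compl @^-1`
    ideal_gen (to_loc prime_compl @` ideal_pow [set` P] n).

End SymbolicPower.

Section FrobeniusPushforward.
Variables (R : comNzRingType) (p : nat).

(* F^e_* R: the additive group of R, with r *: x := r ^ (p ^ e) * x. *)
Definition Fpush (charR : p \in [pchar R]) (e : nat) : Type := R.

Variables (charR : p \in [pchar R]) (e : nat).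
Local Notation FR := (Fpush charR e).

HB.instance Definition _ := GRing.Zmodule.on FR.

Definition Fpush_scale (r : R) (x : FR) : FR := r ^+ (p ^ e)%N * (x : R).

Lemma Fpush_scaleA a b v :
  Fpush_scale a (Fpush_scale b v) = Fpush_scale (a * b) v.
Proof. by rewrite /Fpush_scale exprMn mulrA. Qed.

Lemma Fpush_scale1 : left_id 1 Fpush_scale.
Proof. by move=> v; rewrite /Fpush_scale expr1n mul1r. Qed.

Lemma Fpush_scaleDr : right_distributive Fpush_scale +%R.
Proof. by move=> a u v; rewrite /Fpush_scale [LHS]mulrDr. Qed.

Lemma Fpush_scaleDl v : {morph Fpush_scale^~ v : a b / a + b}.
Proof.
move=> a b; rewrite /Fpush_scale exprDn_pchar ?[LHS]mulrDl //.
by rewrite (eq_pnat _ (pcharf_eq charR)) pnatX pnat_id ?(pcharf_prime charR).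
Qed.

HB.instance Definition _ := GRing.Zmodule_isLmodule.Build R FR
  Fpush_scaleA Fpush_scale1 Fpush_scaleDr Fpush_scaleDl.

Definition Fpt (x : R) : FR := x.

End FrobeniusPushforward.

Section FRegular.
Variables (R : comNzRingType) (p : nat) (charR : p \in [pchar R]).

Definition Fhom (e : nat) := {linear Fpush charR e -> R^o}.

Definition F_finite : Prop :=
  exists2 e, (0 < e)%N &
    exists s : seq (Fpush charR e), forall x : Fpush charR e,
      exists c : nat -> R, x = \sum_(i < size s) c i *: s`_i.

Definition F_splitting (e : nat) (phi : Fhom e) : Prop :=
  (0 < e)%N /\ phi (Fpt charR e 1) = 1.

Definition strongly_F_regular : Prop :=
  [/\ F_finite, reduced R, noetherian R &
    forall d : R, outside_minimal_primes d ->
      exists2 e, (0 < e)%N & exists phi : Fhom e, phi (Fpt charR e d) = 1].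

End FRegular.

Section EssFiniteType.
Variable k : comNzRingType.

Definition finite_type (S : comAlgType k) : Prop :=
  exists s : seq S, forall A : {pred S},
    subalg_closed A -> {subset s <= A} -> forall x, x \in A.

(* [R] is k-isomorphic to a localization of a k-algebra [S] of finite type.
   [loc W] only carries a ring structure, whence the last condition. *)
Definition ess_finite_type (R : comAlgType k) : Prop :=
  exists (S : comAlgType k) (W : mulrClosed S) (f : {rmorphism loc W -> R}),
    [/\ finite_type S, bijective f &
        forall (c : k) (x : S), f (to_loc W (c *: x)) = c *: f (to_loc W x)].

End EssFiniteType.

Section TensorSquare.
Variables (k : comNzRingType) (R : comAlgType k).

(* Finite formal sums of pure tensors (x, y), modulo the congruence generated
   by commutativity of the sum and by the bilinearity relations *)
Inductive tensor_eq : seq (R * R) -> seq (R * R) -> Prop :=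
| tensor_refl s : tensor_eq s s
| tensor_sym s t : tensor_eq s t -> tensor_eq t s
| tensor_trans t s u : tensor_eq s t -> tensor_eq t u -> tensor_eq s u
| tensor_cat s s' t t' :
    tensor_eq s s' -> tensor_eq t t' -> tensor_eq (s ++ t) (s' ++ t')
| tensor_perm s t : perm_eq s t -> tensor_eq s t
| tensor_0l y : tensor_eq [:: (0, y)] [::]
| tensor_Dl x x' y : tensor_eq [:: (x + x', y)] [:: (x, y); (x', y)]
| tensor_Dr x y y' : tensor_eq [:: (x, y + y')] [:: (x, y); (x, y')]
| tensor_Z (c : k) x y : tensor_eq [:: (c *: x, y)] [:: (x, c *: y)].

Local Notation teq := tensor_eq.

Definition tensor_rel (s t : seq (R * R)) : bool := `[< teq s t >].

Lemma tensor_rel_refl : reflexive tensor_rel.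
Proof. by move=> s; apply/asboolP; apply: tensor_refl. Qed.

Lemma tensor_rel_sym : symmetric tensor_rel.
Proof. by move=> s t; apply/asboolP/asboolP; apply: tensor_sym. Qed.

Lemma tensor_rel_trans : transitive tensor_rel.
Proof.
by move=> t s u /asboolP st /asboolP tu; apply/asboolP; apply: tensor_trans tu.
Qed.

Canonical tensor_equiv :=
  EquivRel tensor_rel tensor_rel_refl tensor_rel_sym tensor_rel_trans.

Definition tensor2 := {eq_quot tensor_equiv}.

HB.instance Definition _ := Choice.on tensor2.
HB.instance Definition _ := EqQuotient.on tensor2.

Definition tsum (s : seq (R * R)) : tensor2 := \pi_tensor2 s.

Definition tpure (x y : R) : tensor2 := tsum [:: (x, y)].

Lemma tsumP (a : tensor2) : exists s, a = tsum s.
Proof. by elim/quotW: a => s; exists s. Qed.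

Lemma tsum_eqP s t : tsum s = tsum t <-> teq s t.
Proof.
split=> [/eqP|h]; first by rewrite eqmodE => /asboolP.
by apply/eqP; rewrite eqmodE; apply/asboolP.
Qed.

Lemma tsum_repr s : teq (repr (tsum s)) s.
Proof. by apply/tsum_eqP; rewrite /tsum reprK. Qed.

Definition pre_opp (s : seq (R * R)) := [seq (- x.1, x.2) | x <- s].
Definition pre_mul (s t : seq (R * R)) :=
  [seq (x.1 * y.1, x.2 * y.2) | x <- s, y <- t].

Lemma teq_opp s t : teq s t -> teq (pre_opp s) (pre_opp t).
Proof.
elim=> {s t} /=.
- by move=> s; apply: tensor_refl.
- by move=> s t _; apply: tensor_sym.
- by move=> t s u _ h1 _; apply: tensor_trans.
- by move=> s s' t t' _ h1 _ h2; rewrite /pre_opp !map_cat; apply: tensor_cat.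
- by move=> s t h; apply: tensor_perm; apply: perm_map.
- by move=> y; rewrite oppr0; apply: tensor_0l.
- by move=> x x' y; rewrite opprD; apply: tensor_Dl.
- by move=> x y y'; apply: tensor_Dr.
- by move=> c x y; rewrite -scalerN; apply: tensor_Z.
Qed.

Lemma pre_mul_map a t :
  pre_mul [:: a] t = [seq (a.1 * y.1, a.2 * y.2) | y <- t].
Proof. by rewrite /pre_mul /= cats0. Qed.

Lemma pre_mul_cons a s t : pre_mul (a :: s) t = pre_mul [:: a] t ++ pre_mul s t.
Proof. by rewrite pre_mul_map. Qed.

Lemma pre_mul_cat s s' t : pre_mul (s ++ s') t = pre_mul s t ++ pre_mul s' t.
Proof. by elim: s => //= a s IHs; rewrite pre_mul_cons IHs catA -pre_mul_cons. Qed.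

Lemma pre_mul_perm s s' t : perm_eq s s' -> perm_eq (pre_mul s t) (pre_mul s' t).
Proof. by move=> h; apply: perm_allpairs. Qed.

Lemma teq_pw (f g : R * R -> seq (R * R)) s :
  (forall y, teq (f y) (g y)) ->
  teq (flatten [seq f y | y <- s]) (flatten [seq g y | y <- s]).
Proof.
move=> fg; elim: s => [|a s IHs] /=; first exact: tensor_refl.
exact: tensor_cat.
Qed.

Lemma perm_flatten2 (f g : R * R -> R * R) t :
  perm_eq (flatten [seq [:: f y; g y] | y <- t])
          ([seq f y | y <- t] ++ [seq g y | y <- t]).
Proof.
elim: t => //= a t IHt; rewrite perm_cons.
by rewrite perm_sym -cat1s perm_catCA /= perm_cons perm_sym.
Qed.

Lemma flatten1 (f : R * R -> R * R) t :
  flatten [seq [:: f y] | y <- t] = [seq f y | y <- t].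
Proof. by elim: t => //= a t ->. Qed.

Lemma teq_mull s s' t : teq s s' -> teq (pre_mul s t) (pre_mul s' t).
Proof.
elim=> {s s'}.
- by move=> s; apply: tensor_refl.
- by move=> s u _; apply: tensor_sym.
- by move=> v s u _ h1 _; apply: tensor_trans.
- by move=> s s' u u' _ h1 _ h2; rewrite !pre_mul_cat; apply: tensor_cat.
- by move=> s u h; apply: tensor_perm; apply: pre_mul_perm.
- move=> y; rewrite pre_mul_map -flatten1.
  have ->: pre_mul [::] t = flatten [seq [::] | y <- t] by elim: (t).
  by apply: teq_pw => z /=; rewrite mul0r; apply: tensor_0l.
- move=> x x' y; rewrite (pre_mul_cons _ [:: _]) !pre_mul_map -flatten1.
  apply: tensor_trans _ (tensor_perm (perm_flatten2 _ _ _)).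
  by apply: teq_pw => z /=; rewrite mulrDl; apply: tensor_Dl.
- move=> x y y'; rewrite (pre_mul_cons _ [:: _]) !pre_mul_map -flatten1.
  apply: tensor_trans _ (tensor_perm (perm_flatten2 _ _ _)).
  by apply: teq_pw => z /=; rewrite mulrDl; apply: tensor_Dr.
- move=> c x y; rewrite !pre_mul_map -!flatten1.
  by apply: teq_pw => z /=; rewrite -!scalerAl; apply: tensor_Z.
Qed.

Lemma pre_mulC s t : perm_eq (pre_mul s t) (pre_mul t s).
Proof.
elim: s t => [|a s IHs] t; first by rewrite /pre_mul allpairs0r.
rewrite pre_mul_cons perm_sym perm_allpairs_consr perm_sym.
rewrite pre_mul_map; apply: perm_cat (IHs t).
rewrite (eq_map (g := fun y => (y.1 * a.1, y.2 * a.2))) // => y.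
by congr pair; rewrite mulrC.
Qed.

Lemma pre_mulA s t u : pre_mul s (pre_mul t u) = pre_mul (pre_mul s t) u.
Proof.
elim: s => // a s IHs; rewrite (pre_mul_cons a s) (pre_mul_cons a s t) pre_mul_cat IHs; congr (_ ++ _).
rewrite !pre_mul_map; elim: t {IHs} => //= b t IHt.
rewrite (pre_mul_cons b t) map_cat IHt [RHS]pre_mul_cons; congr (_ ++ _).
by rewrite !pre_mul_map -map_comp; apply: eq_map => y /=; rewrite !mulrA.
Qed.

Lemma teq_mul s s' t t' :
  teq s s' -> teq t t' -> teq (pre_mul s t) (pre_mul s' t').
Proof.
move=> ss' tt'; apply: tensor_trans (teq_mull t ss') _.
apply: tensor_trans (tensor_perm (pre_mulC _ _)) _.
by apply: tensor_trans (teq_mull s' tt') _; apply: tensor_perm (pre_mulC _ _).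
Qed.

Definition tensor_add (a b : tensor2) : tensor2 := tsum (repr a ++ repr b).
Definition tensor_opp (a : tensor2) : tensor2 := tsum (pre_opp (repr a)).
Definition tensor_mul (a b : tensor2) : tensor2 :=
  tsum (pre_mul (repr a) (repr b)).

Lemma tensor_addE s t : tensor_add (tsum s) (tsum t) = tsum (s ++ t).
Proof. by apply/tsum_eqP; apply: tensor_cat; apply: tsum_repr. Qed.

Lemma tensor_oppE s : tensor_opp (tsum s) = tsum (pre_opp s).
Proof. by apply/tsum_eqP; apply: teq_opp; apply: tsum_repr. Qed.

Lemma tensor_mulE s t : tensor_mul (tsum s) (tsum t) = tsum (pre_mul s t).
Proof. by apply/tsum_eqP; apply: teq_mul; apply: tsum_repr. Qed.

Lemma tensor_addA : associative tensor_add.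
Proof.
move=> a b c.
have [[s ->] [t ->] [u ->]] := And3 (tsumP a) (tsumP b) (tsumP c).
by rewrite !tensor_addE catA.
Qed.

Lemma tensor_addC : commutative tensor_add.
Proof.
move=> a b; have [[s ->] [t ->]] := conj (tsumP a) (tsumP b).
rewrite !tensor_addE; apply/tsum_eqP/tensor_perm.
by rewrite perm_catC.
Qed.

Lemma tensor_add0 : left_id (tsum [::]) tensor_add.
Proof. by move=> a; have [s ->] := tsumP a; rewrite tensor_addE. Qed.

Lemma tensor_addN : left_inverse (tsum [::]) tensor_opp tensor_add.
Proof.
move=> a; have [s ->] := tsumP a; rewrite tensor_oppE tensor_addE.
apply/tsum_eqP; elim: s => [|[x y] s IHs] /=; first exact: tensor_refl.
apply: (@tensor_trans ([:: (- x, y); (x, y)] ++ (pre_opp s ++ s))).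
  by apply: tensor_perm; rewrite /= perm_cons -cat1s perm_catCA.
rewrite -[X in teq _ X]/([::] ++ [::]); apply: tensor_cat => //.
apply: tensor_trans (tensor_0l y); rewrite -(addNr x).
exact/tensor_sym/tensor_Dl.
Qed.

Lemma tensor_mulA : associative tensor_mul.
Proof.
move=> a b c.
have [[s ->] [t ->] [u ->]] := And3 (tsumP a) (tsumP b) (tsumP c).
by rewrite !tensor_mulE pre_mulA.
Qed.

Lemma tensor_mulC : commutative tensor_mul.
Proof.
move=> a b; have [[s ->] [t ->]] := conj (tsumP a) (tsumP b).
rewrite !tensor_mulE; apply/tsum_eqP/tensor_perm.
exact: pre_mulC.
Qed.

Lemma tensor_mul1 : left_id (tpure 1 1) tensor_mul.
Proof.
move=> a; have [s ->] := tsumP a; rewrite tensor_mulE pre_mul_map.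
by rewrite (eq_map (g := id)) ?map_id // => -[x y] /=; rewrite !mul1r.
Qed.

Lemma tensor_mulDl : left_distributive tensor_mul tensor_add.
Proof.
move=> a b c.
have [[s ->] [t ->] [u ->]] := And3 (tsumP a) (tsumP b) (tsumP c).
by rewrite !(tensor_addE, tensor_mulE) pre_mul_cat.
Qed.

HB.instance Definition _ := GRing.isZmodule.Build tensor2
  tensor_addA tensor_addC tensor_add0 tensor_addN.

Definition tensor_mu (a : tensor2) : R := \sum_(z <- repr a) z.1 * z.2.

Lemma teq_sum s t : teq s t ->
  \sum_(z <- s) z.1 * z.2 = \sum_(z <- t) z.1 * z.2.
Proof.
elim=> {s t} //.
- by move=> t s u _ -> _ ->.
- by move=> s s' t t' _ h1 _ h2; rewrite !big_cat h1 h2.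
- by move=> s t h; apply: perm_big.
- by move=> y; rewrite big_seq1 big_nil mul0r.
- by move=> x x' y; rewrite !big_cons !big_nil /= !addr0 mulrDl.
- by move=> x y y'; rewrite !big_cons !big_nil /= !addr0 mulrDr.
- by move=> c x y; rewrite !big_seq1 -scalerAl -scalerAr.
Qed.

Lemma tensor_muE s : tensor_mu (tsum s) = \sum_(z <- s) z.1 * z.2.
Proof. exact/teq_sum/tsum_repr. Qed.

Lemma tensor_one_neq0 : tpure 1 1 != 0 :> tensor2.
Proof.
apply/eqP => /(congr1 tensor_mu); rewrite [0](_ : _ = tsum [::]) // !tensor_muE.
by rewrite big_seq1 big_nil mulr1 => /eqP; rewrite oner_eq0.
Qed.

HB.instance Definition _ := GRing.Zmodule_isComNzRing.Build tensor2
  tensor_mulA tensor_mulC tensor_mul1 tensor_mulDl tensor_one_neq0.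

Lemma tensor_mu_pure x y : tensor_mu (tpure x y) = x * y.
Proof. by rewrite tensor_muE big_seq1. Qed.

Lemma tensor_mu_zmod : zmod_morphism tensor_mu.
Proof.
move=> a b; have [[s ->] [t ->]] := conj (tsumP a) (tsumP b).
rewrite [_ - _](_ : _ = tensor_add (tsum s) (tensor_opp (tsum t))) //.
rewrite tensor_oppE tensor_addE !tensor_muE big_cat big_map /=; congr (_ + _).
by rewrite -sumrN; apply: eq_bigr => z _; rewrite mulNr.
Qed.

Lemma tensor_mu_monoid : monoid_morphism tensor_mu.
Proof.
split=> [|a b]; first by rewrite tensor_mu_pure mulr1.
have [[s ->] [t ->]] := conj (tsumP a) (tsumP b).
rewrite [_ * _](_ : _ = tensor_mul (tsum s) (tsum t)) //.
rewrite tensor_mulE !tensor_muE big_allpairs_dep mulr_suml.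
apply: eq_bigr => x _; rewrite mulr_sumr; apply: eq_bigr => y _.
by rewrite mulrACA.
Qed.

HB.instance Definition _ :=
  GRing.isZmodMorphism.Build tensor2 R tensor_mu tensor_mu_zmod.
HB.instance Definition _ :=
  GRing.isMonoidMorphism.Build tensor2 R tensor_mu tensor_mu_monoid.

Lemma tensor_pchar p : p \in [pchar R] -> p \in [pchar tensor2].
Proof.
case/andP=> p_pr /eqP p0; apply/andP; split=> //; apply/eqP.
have nat_pure n : n%:R = tpure n%:R 1 :> tensor2.
  elim: n => [|n IHn]; first exact/esym/tsum_eqP/tensor_0l.
  rewrite mulrSr IHn [LHS](_ : _ = tensor_add (tpure n%:R 1) (tpure 1 1)) //.
  by rewrite tensor_addE mulrSr; apply/esym/tsum_eqP/tensor_Dl.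
rewrite nat_pure p0; exact/tsum_eqP/tensor_0l.
Qed.

End TensorSquare.

Lemma alg_pchar (k : fieldType) (R : comAlgType k) p :
  p \in [pchar k] -> p \in [pchar R].
Proof. by rewrite (pchar_lalg R). Qed.

Section DiagonalCartier.
Variables (k : comNzRingType) (R : comAlgType k).
Variables (p : nat) (charR : p \in [pchar R]).

Definition diagonal_cartier2 (e : nat) : set (Fhom charR e) :=
  [set psi | exists psi2 : Fhom (tensor_pchar charR) e,
     forall z : tensor2 R, tensor_mu (psi2 (Fpt _ e z)) =
                           psi (Fpt charR e (tensor_mu z))].

Definition diagonal_cartier2_F_split : Prop :=
  exists e (psi : Fhom charR e), diagonal_cartier2 psi /\ F_splitting psi.

End DiagonalCartier.

(* Main.v *)
Require Import Defs.
From HB Require Import structures.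
From mathcomp Require Import all_boot all_order all_algebra ring_quotient.
From mathcomp Require Import boolp classical_sets reals.
From mathcomp Require Import ring zify.

Set Implicit Arguments.
Unset Strict Implicit.
Unset Printing Implicit Defensive.

Import GRing.Theory.

Local Open Scope classical_set_scope.
Local Open Scope ring_scope.

(* Write a + 1, b + 1 for the two exponents on the right; the hypotheses force
   a + b + 2h < N. Composing the given splitting and its lift with themselves
   gives q^-1-linear maps phi on R and Phi on R (x) R with mu o Phi = phi o mu
   and phi(1) = 1, for q an arbitrarily large power of p. For x in p^(N) and
   i close to q(a + h) / N, put t = Phi(x^i (x) x^(q-i)), so that
   mu(t) = phi(x^q) = x. It remains to see that t lies in
   p^(a+1) (x) p^(b+1), and over a field this can be tested by contracting with
   linear functionals on either factor. Since Phi is q^-1-linear, the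
   contractions on the first factor land in p^(a+1) as soon as x^i lies, locally
   at p, in the ideal generated by the q-th powers of elements of the ordinary
   power of p with exponent a + 1.
   This holds because the ordinary power p^M lies locally in that ideal once
   M > q(a + h) + C with C independent of q. Order the monomials in generators
   of p by degree and then by weight, and call a monomial standard if locally it
   is not a combination of higher ones. A box of standard monomials with side B
   in s variables yields a chain of length B^s, whereas the localization at p of
   R/(x_1^n, ..., x_h^n), for parameters x_i, has length O(n^h). Hence a standard
   monomial has at most h large exponents, and one of large degree is a multiple
   of a product of a + 1 q-th powers of generators. *)

(** * Ideals, primes and parameters *)

Section IdealTheory.
Variable R : comPzRingType.
Implicit Types (I J : set R) (A B : set R).

Lemma ideal0 I : ideal I -> I 0.
Proof. by case. Qed.

Lemma idealMl I a x : ideal I -> I x -> I (a * x).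
Proof. by case=> I0 Ia Ix; rewrite -[_ * _]addr0; apply: Ia. Qed.

Lemma idealD I x y : ideal I -> I x -> I y -> I (x + y).
Proof. by case=> I0 Ia Ix Iy; rewrite -[x]mul1r; apply: Ia. Qed.

Lemma idealB I x y : ideal I -> I x -> I y -> I (x - y).
Proof. by move=> Iid Ix Iy; rewrite -mulN1r; apply: idealD => //; exact: idealMl. Qed.

Lemma ideal_gen_ideal A : ideal (ideal_gen A).
Proof.
split=> [I [[I0 _] _]|a x y Ax Ay I [Iid AI]] //.
by apply: Iid.2; [apply: Ax|apply: Ay].
Qed.

Lemma sub_ideal_gen A : A `<=` ideal_gen A.
Proof. exact: sub_gen_smallest. Qed.

Lemma ideal_gen_sub A I : ideal I -> A `<=` I -> ideal_gen A `<=` I.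
Proof. exact: smallest_sub. Qed.

Lemma ideal_genS A B : A `<=` ideal_gen B -> ideal_gen A `<=` ideal_gen B.
Proof. exact: ideal_gen_sub (ideal_gen_ideal B). Qed.

Lemma ideal_mulM I J x y : I x -> J y -> ideal_mul I J (x * y).
Proof. by move=> Ix Jy; apply: sub_ideal_gen; exists x => //; exists y. Qed.

Lemma ideal_mulS I I' J J' :
  I `<=` I' -> J `<=` J' -> ideal_mul I J `<=` ideal_mul I' J'.
Proof.
move=> II' JJ'; apply: ideal_genS => _ [x Ix [y Jy <-]].
exact: ideal_mulM (II' _ Ix) (JJ' _ Jy).
Qed.

Lemma ideal_pow_ideal I n : ideal (ideal_pow I n).
Proof. by case: n => [|n]; [split|apply: ideal_gen_ideal]. Qed.

Lemma ideal_powD I m n x y :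
  ideal_pow I m x -> ideal_pow I n y -> ideal_pow I (m + n) (x * y).
Proof.
move=> + Iy; elim: m x => [|m IHm] x Ix.
  exact: idealMl (ideal_pow_ideal _ _) Iy.
have Kid : ideal [set z | ideal_pow I (m.+1 + n) (z * y)].
  have Iid := ideal_pow_ideal I (m.+1 + n).
  split=> [|a u v]; rewrite /mkset ?mul0r; first exact: ideal0.
  by rewrite mulrDl -mulrA; apply: Iid.2.
move: x Ix; apply: (ideal_gen_sub Kid) => _ [u Iu [v Iv <-]] /=.
by rewrite -mulrA; apply: ideal_mulM => //; apply: IHm.
Qed.

Lemma ideal_powS I m n : (n <= m)%N -> ideal_pow I m `<=` ideal_pow I n.
Proof.
move=> /subnK <- ; elim: (m - n)%N => [//|d IHd] x.
apply: (ideal_gen_sub (ideal_pow_ideal _ _)) => _ [u _ [v Iv <-]].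
by apply: idealMl (ideal_pow_ideal _ _) _; apply: IHd.
Qed.

Lemma ideal_pow1 I : ideal I -> ideal_pow I 1 `<=` I.
Proof.
move=> Iid; apply: ideal_gen_sub => // _ [x Ix [y _ <-]].
by rewrite mulrC; apply: idealMl.
Qed.

Lemma ideal_powX I m n x : ideal_pow I m x -> ideal_pow I (m * n) (x ^+ n).
Proof.
move=> Ix; elim: n => [|n IHn]; first by rewrite muln0.
by rewrite mulnS exprS; apply: ideal_powD.
Qed.

Definition ideal_adjoin I x : set R := [set y | exists a z, I z /\ y = a * x + z].

Lemma ideal_adjoin_ideal I x : ideal I -> ideal (ideal_adjoin I x).
Proof.
move=> Iid; split; first by exists 0, 0; split; [apply: ideal0|rewrite mul0r addr0].
move=> a _ _ [b [y [Iy ->]]] [c [z [Iz ->]]].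
by exists (a * b + c), (a * y + z); split; [apply: Iid.2|ring].
Qed.

Lemma sub_ideal_adjoin I x : I `<=` ideal_adjoin I x.
Proof. by move=> y Iy; exists 0, y; rewrite mul0r add0r. Qed.

Lemma mem_ideal_adjoin I x : ideal I -> ideal_adjoin I x x.
Proof. by move=> Iid; exists 1, 0; split; [apply: ideal0|rewrite mul1r addr0]. Qed.

(** By Zorn: the union of a chain of ideals is an ideal, hence finitely generated, and one member of
    the chain already contains all the generators. *)
Lemma noetherian_maximal (F : set (set R)) :
  noetherian R -> F `<=` ideal (R:=R) -> F !=set0 ->
  exists2 I, F I & forall J, F J -> I `<=` J -> J = I.
Proof.
move=> noeth Fid [I0 FI0].
(* [Zorn_bigcup] also asks for the union of the empty chain; adjoining [set0] provides it, and a
   maximal member cannot be [set0] because [F] contains a nonempty ideal. *)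
pose F' := F `|` [set set0].
have [|I [F'I maxI]] := @Zorn_bigcup R F'.
  move=> G GF' totG.
  have [[J GJ J0]|noJ] := pselect (exists2 J, G J & J !=set0); last first.
    right; apply/seteqP; split=> // x [J GJ Jx].
    by apply: noJ; exists J => //; exists x.
  left; set U := \bigcup_(X in G) X.
  have Gid K : G K -> K !=set0 -> F K.
    by move=> /GF'[//|->] [].
  have Uid : ideal U.
    split; first by exists J => //; apply: ideal0 (Fid _ (Gid _ _ _)).
    move=> a x y [X GX Xx] [Y GY Yy].
    have [XY|YX] := totG _ _ GX GY.
      by exists Y => //; apply: (Fid _ (Gid _ GY _)).2 => //; [exists y|apply: XY].
    by exists X => //; apply: (Fid _ (Gid _ GX _)).2 => //; [exists x|apply: YX].
  have [s Us] := noeth U Uid.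
  suff [K [GK K0] sK] : exists2 K, G K /\ K !=set0 & {in s, forall x, K x}.
    rewrite (_ : U = K); first exact: Gid.
    apply/seteqP; split=> [x|x Kx]; last by exists K.
    by rewrite Us; apply: ideal_gen_sub; [apply: Fid; apply: Gid|].
  have {Us} : {in s, forall x, U x} by move=> x xs; rewrite Us; apply: sub_ideal_gen.
  elim: s => [|x s IHs] sU; first by exists J.
  have [y ys|K [GK K0] sK] := IHs; first by apply: sU; rewrite inE ys orbT.
  have [X GX Xx] := sU x (mem_head _ _).
  have [XK|KX] := totG _ _ GX GK.
    by exists K => // y; rewrite inE => /predU1P[->|/sK//]; apply: XK.
  exists X; first by split=> //; exists x.
  by move=> y; rewrite inE => /predU1P[->//|/sK]; apply: KX.
have FI : F I.
  case: F'I => // I0'; exfalso; apply: (maxI I0); last by left.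
  rewrite I0'; split=> // /(_ 0 _); apply; exact: ideal0 (Fid _ _).
exists I => // J FJ IJ; apply: contrapT => JI; apply: (maxI J); last by left.
by split=> // JI'; apply: JI; apply/seteqP.
Qed.

End IdealTheory.

Section PrimeTheory.
Variable R : comNzRingType.
Implicit Types (P Q : prime_idealr R) (I : set R) (s : seq (prime_idealr R)).

Lemma prime_ideal P : ideal [set` P].
Proof.
split=> [|a x y] /=; first exact: rpred0.
by move=> Px Py; rewrite rpredD // idealMr.
Qed.

Lemma prime_notin1 P : 1 \notin P.
Proof. by rewrite idealr1. Qed.

Lemma prime_notinM P x y : x \notin P -> y \notin P -> x * y \notin P.
Proof. by move=> xP yP; rewrite prime_idealrM negb_or xP. Qed.

Lemma prime_inX P x n : x ^+ n \in P -> x \in P.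
Proof.
elim: n => [|n IHn]; first by rewrite expr0 idealr1.
by rewrite exprS prime_idealrM => /orP[].
Qed.

Lemma prime_notinX P x n : x \notin P -> x ^+ n \notin P.
Proof. by apply: contra; apply: prime_inX. Qed.

Lemma prime_of_set I : ideal I -> ~ I 1 ->
  (forall x y, I (x * y) -> I x \/ I y) -> exists P, [set` P] = I.
Proof.
move=> Iid I1 Ipr; pose S : R -> bool := fun x => `[< I x >].
have Sid : idealr_closed S.
  split; rewrite ?unfold_in /S; first by apply/asboolP; apply: ideal0.
    exact/asboolP.
  move=> a x y; rewrite !unfold_in /S => /asboolP Ix /asboolP Iy.
  by apply/asboolP; apply: Iid.2.
have Spr : prime_idealr_closed S.
  move=> x y; rewrite !unfold_in /S => /asboolP/Ipr[Ix|Iy]; apply/orP.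
    by left; apply/asboolP.
  by right; apply/asboolP.
pose iM := isIdealr.Build R S Sid.
pose pM := isPrimeIdealrClosed.Build R S Spr.
pose P : prime_idealr R := HB.pack S iM pM.
exists P; apply/seteqP; split=> x /=; rewrite !unfold_in /= /S; first by move/asboolP.
by move=> Ix; apply/asboolP.
Qed.

(** The products [u * g ^+ n] with [u] outside [P] form a multiplicative set, so an ideal maximal
    among those that avoid it is prime. Taking [n = 0] puts it inside [P]; taking [u = 1], [n = 1]
    keeps [g] out. *)
Lemma prime_avoiding_powers I (P : prime_idealr R) (g : R) :
  noetherian R -> ideal I ->
  (forall n u, u \notin P -> ~ I (u * g ^+ n)) ->
  exists Q, [/\ I `<=` [set` Q], [set` Q] `<=` [set` P] & g \notin Q].
Proof.
move=> noeth Iid Iav.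
pose F := [set J : set R | [/\ ideal J, I `<=` J &
  forall n u, u \notin P -> ~ J (u * g ^+ n)]].
have [||J [Jid IJ Jav] maxJ] := @noetherian_maximal R F noeth.
- by move=> J [].
- by exists I; split.
have meet x : ~ J x -> exists n u, u \notin P /\ ideal_adjoin J x (u * g ^+ n).
  move=> Jx; apply: contrapT => nmeet; apply: Jx.
  rewrite -(maxJ (ideal_adjoin J x)); last exact: sub_ideal_adjoin.
    exact: mem_ideal_adjoin.
  split; first exact: ideal_adjoin_ideal.
    by move=> y /IJ; apply: sub_ideal_adjoin.
  by move=> n u uP Jug; apply: nmeet; exists n, u.
have [||Q QJ] := @prime_of_set J Jid.
- by move=> J1; apply: (Jav 0%N 1 (prime_notin1 P)); rewrite mulr1.
- move=> x y Jxy; apply: contrapT => /not_orP[/meet Jx /meet Jy].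
  case: Jx => n [u [uP [a [z [Jz ez]]]]]; case: Jy => m [v [vP [b [w [Jw ew]]]]].
  apply: (Jav (n + m)%N (u * v)); first exact: prime_notinM.
  rewrite (_ : _ * _ = a * b * (x * y) + (a * x * w + (b * y + w) * z)).
    by apply: Jid.2 => //; apply: idealD => //; apply: idealMl.
  transitivity ((u * g ^+ n) * (v * g ^+ m)); first by rewrite exprD; ring.
  by rewrite ez ew; ring.
exists Q; rewrite QJ; split=> //.
  move=> x Jx /=; apply: contrapT => /negP xP.
  by apply: (Jav 0%N x xP); rewrite mulr1.
apply/negP => gQ; apply: (Jav 1%N 1 (prime_notin1 P)).
by rewrite mul1r; have : [set` Q] g by []; rewrite QJ.
Qed.

(** Noetherian induction: a maximal counterexample [J] is proper and not prime, so it contains some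
    [x * y] with neither factor in [J]. A prime over [J] contains [x] or [y], so the lists for
    [J + (x)] and [J + (y)] together serve [J]. *)
Lemma noetherian_primes_over I : noetherian R -> ideal I ->
  exists2 s : seq (set R), {in s, forall J, exists Q, [set` Q] = J} &
    forall Q, I `<=` [set` Q] -> exists2 J, J \in s & I `<=` J /\ J `<=` [set` Q].
Proof.
move=> noeth; apply: contraPP => Ibad Iid.
pose good J := exists2 s : seq (set R), {in s, forall J, exists Q, [set` Q] = J} &
    forall Q, J `<=` [set` Q] -> exists2 J', J' \in s & J `<=` J' /\ J' `<=` [set` Q].
have [||J [Jid Jbad] maxJ] := @noetherian_maximal R [set J | ideal J /\ ~ good J] noeth.
- by move=> J [].
- by exists I; split.
have adj x : ~ J x -> good (ideal_adjoin J x).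
  move=> Jx; apply: contrapT => Jxbad; apply: Jx.
  rewrite -(maxJ (ideal_adjoin J x)); last exact: sub_ideal_adjoin.
    exact: mem_ideal_adjoin.
  by split=> //; apply: ideal_adjoin_ideal.
have [J1|J1] := pselect (J 1).
  apply: Jbad; exists [::] => // Q /(_ 1 J1) /=.
  by rewrite (negPf (prime_notin1 Q)).
have [Jpr|] := pselect (forall x y, J (x * y) -> J x \/ J y).
  apply: Jbad; exists [:: J].
    by move=> K; rewrite inE => /eqP->; apply: prime_of_set.
  by move=> Q JQ; exists J; [exact: mem_head|split].
move=> /existsNP[x /existsNP[y /not_implyP[Jxy /not_orP[Jx Jy]]]].
have [[s sP sJ] [t tP tJ]] := conj (adj x Jx) (adj y Jy).
apply: Jbad; exists (s ++ t) => [K|Q JQ].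
  by rewrite mem_cat => /orP[/sP|/tP].
have /= := JQ _ Jxy; rewrite prime_idealrM => /orP[] Q'.
  have [|K Ks [JK KQ]] := sJ Q.
    move=> _ [a [z [Jz ->]]] /=; apply: idealD (prime_ideal Q) _ (JQ _ Jz).
    exact: idealMl (prime_ideal Q) Q'.
  exists K; rewrite ?mem_cat ?Ks //; split=> // z /(sub_ideal_adjoin x); exact: JK.
have [|K Kt [JK KQ]] := tJ Q.
  move=> _ [a [z [Jz ->]]] /=; apply: idealD (prime_ideal Q) _ (JQ _ Jz).
  exact: idealMl (prime_ideal Q) Q'.
exists K; rewrite ?mem_cat ?Kt ?orbT //; split=> // z /(sub_ideal_adjoin y); exact: JK.
Qed.

(** Induction on the number of primes. Members contained in the first prime [J] are avoided together
    with [J], so the induction hypothesis is applied to the others. *)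
Lemma prime_avoidance I (s : seq (set R)) : ideal I ->
  {in s, forall J, exists Q, [set` Q] = J} -> {in s, forall J, ~ I `<=` J} ->
  exists2 x, I x & {in s, forall J, ~ J x}.
Proof.
move=> Iid; move: {2}(size s).+1 (ltnSn (size s)) => n.
elim: n s => // n IHn [|J s] /= ss sP sI; first by exists 0 => //; apply: ideal0.
pose s' := [seq K <- s | ~~ `[< K `<=` J >]].
have s's K : K \in s' -> K \in s /\ ~ K `<=` J.
  by rewrite mem_filter => /andP[/asboolPn].
have [|K /s's[Ks _]|K /s's[Ks _]|x Ix xs'] := IHn s'.
- by apply: (@leq_ltn_trans (size s)); rewrite ?size_filter ?count_size.
- by apply: sP; rewrite inE Ks orbT.
- by apply: sI; rewrite inE Ks orbT.
suff [y [Iy Jy ys']] : exists y, [/\ I y, ~ J y & {in s', forall K, ~ K y}].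
  exists y => // K; rewrite inE => /predU1P[->//|Ks].
  have [KJ /KJ//|KJ] := pselect (K `<=` J).
  by apply: ys'; rewrite mem_filter Ks andbT; apply/asboolPn.
have [Jx|Jx] := pselect (J x); last by exists x.
have [Q QJ] := sP J (mem_head _ _).
(* Adding such a [y] moves [x] out of [J] without moving it into any [K]. It is a product of an
   element of [I] and elements of each [K], all outside the prime [J]. *)
suff [y [Iy Jy ys']] : exists y, [/\ I y, ~ J y & {in s', forall K, K y}].
  exists (x + y); split; first exact: idealD.
    move=> Jxy; apply: Jy; rewrite -(addKr x y) addrC.
    by rewrite -QJ in Jx Jxy *; apply: idealB (prime_ideal Q) _ _.
  move=> K Ks' Kxy; apply: (xs' K Ks'); rewrite -(addrK y x).
  have [Ks _] := s's K Ks'; have [|Q' Q'K] := sP K; first by rewrite inE Ks orbT.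
  by move: (ys' K Ks'); rewrite -Q'K in Kxy *; apply: idealB (prime_ideal Q') _.
have {}s's K : K \in s' -> (exists Q, [set` Q] = K) /\ ~ K `<=` J.
  by move=> /s's[Ks KJ]; split=> //; apply: sP; rewrite inE Ks orbT.
rewrite -{}QJ in sI s's *; move: s' s's {xs'} => s'.
elim: s' => [|K s' IHs'] s'P.
  have /existsNP[y /not_implyP[]] := sI _ (mem_head _ _); by exists y.
have [L Ls'|y [Iy Qy ys']] := IHs'; first by apply: s'P; rewrite inE Ls' orbT.
have [[Q' Q'K] /existsNP[z /not_implyP[Kz Qz]]] := s'P K (mem_head _ _).
exists (y * z); split; first by rewrite mulrC; apply: idealMl.
  by apply/negP; apply: prime_notinM; apply/negP.
move=> L; rewrite inE => /predU1P[->|Ls'].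
  by rewrite -Q'K in Kz *; apply: idealMl (prime_ideal Q') Kz.
have [|[Q'' Q''L] _] := s'P L; first by rewrite inE Ls' orbT.
by move: (ys' L Ls'); rewrite -Q''L mulrC; apply: idealMl (prime_ideal Q'').
Qed.

Lemma prime_chain_ext P Q c n : prime_chain P n c -> [set` P] `<` [set` Q] ->
  exists c', prime_chain Q n.+1 c'.
Proof.
move=> [cinc cP] PQ; exists (fun i => if (i <= n)%N then c i else Q).
split=> [i|]; last by rewrite ltnn.
rewrite ltnS => le_in; rewrite le_in; case: ltnP => [/cinc//|le_ni].
by rewrite (anti_leq (_ : i <= n <= i)%N) ?le_in // cP.
Qed.

Lemma prime_chain_trunc P c n m : (m <= n)%N -> prime_chain P n c ->
  exists c', prime_chain P m c'.
Proof.
move=> le_mn [cinc cP]; exists (fun i => c (n - m + i)%N); split=> [i im|].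
  by rewrite addnS; apply: cinc; rewrite -ltn_subRL subKn.
by rewrite subnK.
Qed.

(** Each new parameter is taken in [P] but outside the finitely many relevant primes over the
    previous ones that do not contain [P]. Thus a prime below [P] containing the first [i]
    parameters ends a chain of length [i]; for [i = h], a prime strictly below [P] would give a
    chain longer than the height. *)
Lemma height_parameters P h : noetherian R -> has_height P h ->
  exists x : seq R, [/\ size x = h, {in x, forall y, y \in P} &
    forall Q, [set` Q] `<=` [set` P] -> {in x, forall y, y \in Q} ->
      [set` Q] = [set` P]].
Proof.
move=> noeth [[c cP] hmax].
have inv i : (i <= h)%N -> exists x : seq R, [/\ size x = i, {in x, forall y, y \in P} &
    forall Q, [set` Q] `<=` [set` P] -> {in x, forall y, y \in Q} ->
      exists c', prime_chain Q i c'].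
  elim: i => [_|i IHi lt_ih].
    by exists [::]; split=> // Q _ _; exists (fun=> Q).
  have [x [sx xP xQ]] := IHi (ltnW lt_ih).
  have [s sP sx'] := noetherian_primes_over noeth (ideal_gen_ideal [set` x]).
  pose s' := [seq J <- s | ~~ `[< [set` P] `<=` J >]].
  have [||z Pz zs'] := prime_avoidance (prime_ideal P) (s := s').
  - by move=> J; rewrite mem_filter => /andP[_ /sP].
  - by move=> J; rewrite mem_filter => /andP[/asboolPn].
  exists (z :: x); split=> /= [|y|Q QP zxQ]; first by rewrite sx.
    by rewrite inE => /predU1P[->//|/xP].
  have [|J Js [xJ JQ]] := sx' Q.
    apply: ideal_gen_sub (prime_ideal Q) _ => y yx.
    by apply: zxQ; rewrite inE [y \in x]yx orbT.
  (* If [J] contains [P] then [Q] is [P], and the given chain of length [h] can be truncated.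
     Otherwise [z] separates [J] from [Q], and the chain ending at [J] is prolonged by [Q]. *)
  have [PJ|PJ] := pselect ([set` P] `<=` J).
    have PQ : [set` P] = [set` Q] by apply/seteqP; split=> // y /PJ /JQ.
    have [c' [c'inc c'P]] := prime_chain_trunc lt_ih cP.
    by exists c'; split=> //; rewrite c'P PQ.
  have [Q' Q'J] := sP J Js; rewrite -Q'J in xJ JQ PJ.
  have [||c' c'Q'] := xQ Q'.
  - by move=> y /JQ /QP.
  - by move=> y yx; apply: xJ; apply: sub_ideal_gen.
  apply: prime_chain_ext c'Q' _; split=> // QQ'.
  apply: (zs' [set` Q']); last by apply: QQ'; apply: zxQ; rewrite mem_head.
  by rewrite mem_filter Q'J Js andbT; apply/asboolPn; rewrite -Q'J.
have [x [sx xP xQ]] := inv h (leqnn h).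
exists x; split=> // Q QP Qx; apply: contrapT => QneP.
have [c' c'Q] := xQ Q QP Qx.
have [|c'' /hmax] := prime_chain_ext c'Q (Q := P); last by rewrite ltnn.
by split=> // PQ; apply: QneP; apply/seteqP.
Qed.

(** Otherwise some prime inside [P] would contain [x] and miss [g]; but [P] itself is the only prime
    inside [P] that contains [x]. *)
Lemma parameters_radical P (x : seq R) g : noetherian R ->
  (forall Q, [set` Q] `<=` [set` P] -> {in x, forall y, y \in Q} ->
      [set` Q] = [set` P]) ->
  g \in P -> exists n u, u \notin P /\ ideal_gen [set` x] (u * g ^+ n).
Proof.
move=> noeth xQ gP; apply: contrapT => gx.
have [|n u uP ugx|Q [xsQ QP]] :=
    @prime_avoiding_powers (ideal_gen [set` x]) P g noeth.
- exact: ideal_gen_ideal.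
- by apply: gx; exists n, u.
have QeqP : [set` Q] = [set` P].
  by apply: xQ => // y yx; apply: xsQ; apply: sub_ideal_gen.
have : [set` P] g by [].
by rewrite -QeqP /= => ->.
Qed.

End PrimeTheory.

(** * Length of local quotients *)

Section Length.
Variables (R : comNzRingType) (P : prime_idealr R).
Implicit Types (I J : set R) (A B : seq R).

(** These are the contractions of ideals of the localization at [P]; local statements are phrased
    through them, without fractions. *)
Definition saturated I :=
  ideal I /\ forall u x, u \notin P -> I (u * x) -> I x.

Definition saturation I : set R := [set x | exists2 u, u \notin P & I (u * x)].

Lemma saturation_saturated I : ideal I -> saturated (saturation I).
Proof.
move=> Iid; split.
  split; first by exists 1; [exact: prime_notin1|rewrite mulr0; apply: ideal0].
  move=> a x y [u uP Iux] [v vP Ivy]; exists (u * v); first exact: prime_notinM.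
  rewrite (_ : _ * _ = (v * a) * (u * x) + u * (v * y)); last by ring.
  by apply: Iid.2 => //; apply: idealMl.
move=> u x uP [v vP Ivux]; exists (v * u); first exact: prime_notinM.
by rewrite -mulrA.
Qed.

Lemma sub_saturation I : I `<=` saturation I.
Proof. by move=> x Ix; exists 1; rewrite ?mul1r ?prime_notin1. Qed.

Lemma saturation_sub I J : saturated J -> I `<=` J -> saturation I `<=` J.
Proof. by move=> [_ Jsat] IJ x [u uP /IJ]; apply: Jsat. Qed.

(* The length of the localization at [P] of R/A is at most r, read off
   decreasing chains of saturated ideals containing A. *)
Definition length_le A (r : nat) := forall n (J : nat -> set R),
  (forall i, saturated (J i)) -> (forall i, J i.+1 `<=` J i) ->
  {in A, forall x, J n x} -> (\sum_(i < n) `[< J i <> J i.+1 >] <= r)%N.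

Lemma chain_sub (J : nat -> set R) i j :
  (forall i, J i.+1 `<=` J i) -> (i <= j)%N -> J j `<=` J i.
Proof.
move=> Jdec /subnK <-; elim: (j - i)%N => [//|d IHd] x Jx.
by apply: IHd; apply: Jdec.
Qed.

Lemma length_le_sub A B r :
  {in B, forall x, saturation (ideal_gen [set` A]) x} ->
  length_le B r -> length_le A r.
Proof.
move=> BA lenB n J Jsat Jdec AJ; apply: lenB => // x /BA.
apply: saturation_sub => //; apply: ideal_gen_sub (Jsat n).1 _ => y; exact: AJ.
Qed.

Lemma length_le_mem A B r : {subset B <= A} -> length_le B r -> length_le A r.
Proof.
move=> BA; apply: length_le_sub => x /BA Ax.
by apply: sub_saturation; apply: sub_ideal_gen.
Qed.

(** Additivity of length along multiplication by [z], as [B] lies in the colon ideal [A : z]. By the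
    modular law, a step of a chain is strict only if it remains strict after adding [z] ([J1]) or
    after taking the colon by [z] ([J2]). *)
Lemma length_le_colon z A B a b : length_le (z :: A) a -> length_le B b ->
  {in B, forall x, ideal_gen [set` A] (z * x)} -> length_le A (a + b).
Proof.
move=> lenA lenB BA n J Jsat Jdec AJ.
pose J1 i := saturation (ideal_adjoin (J i) z).
pose J2 i := [set x | J i (z * x)].
have J1sat i : saturated (J1 i).
  by apply: saturation_saturated; apply: ideal_adjoin_ideal; apply: (Jsat i).1.
have J2sat i : saturated (J2 i).
  have [Jid Js] := Jsat i; rewrite /J2; split.
    split=> [|c x y]; rewrite /mkset ?mulr0; first exact: ideal0.
    by rewrite mulrDr mulrCA; apply: Jid.2.
  by move=> u x uP; rewrite /mkset mulrCA; apply: Js.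
have Aid : ideal_gen [set` A] `<=` J n.
  by apply: ideal_gen_sub (Jsat n).1 _ => y; apply: AJ.
apply: leq_trans (leq_add (lenA n J1 J1sat _ _) (lenB n J2 J2sat _ _)).
- rewrite -big_split /= leq_sum // => i _.
  case: asboolP => // Jne.
  have [J1e|J1e] := pselect (J1 i = J1 i.+1); last by rewrite (asboolT J1e).
  have [J2e|J2e] := pselect (J2 i = J2 i.+1); last by rewrite (asboolT J2e) addnC.
  exfalso; apply: Jne; apply/seteqP; split=> [y Jy|]; last exact: Jdec.
  have [Jid Js] := Jsat i.+1.
  have : J1 i y by apply: sub_saturation; apply: sub_ideal_adjoin.
  rewrite J1e => -[u uP [c [w [Jw e]]]].
  have : J2 i c.
    rewrite /J2 /mkset mulrC -(addrK w (c * z)) -e.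
    by apply: idealB (Jsat i).1 _ _; [apply: idealMl (Jsat i).1 Jy|apply: Jdec].
  rewrite J2e => Jzc; apply: (Js u) => //.
  by rewrite e mulrC; apply: idealD.
- move=> i x [u uP [c [w [Jw e]]]]; exists u => //; exists c, w; split=> //.
  exact: Jdec.
- move=> x; rewrite inE => /predU1P[->|/AJ Jx]; apply: sub_saturation.
    exact: mem_ideal_adjoin (Jsat n).1.
  exact: sub_ideal_adjoin.
- by move=> i x; apply: Jdec.
- by move=> x /BA /Aid.
Qed.

(** Filter by the powers of [z]: each of the [n] layers is a quotient of the ring modulo
    [z :: A]. *)
Lemma length_le_expn z A r n :
  length_le (z :: A) r -> length_le (z ^+ n :: A) (n * r).
Proof.
move=> lenA; elim: n => [|n IHn].
  move=> k J Jsat Jdec AJ; rewrite mul0n leqn0 sum_nat_eq0.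
  apply/forallP => i; rewrite implyTb eqb0; apply/asboolPn; apply.
  suff JT j : (j <= k)%N -> J j = setT by rewrite !JT // ltnW.
  move=> jk; apply/seteqP; split=> // x _; apply: (chain_sub Jdec jk).
  by rewrite -[x]mulr1; apply: idealMl (Jsat k).1 _; apply: AJ; rewrite mem_head.
rewrite mulSn addnC; apply: (length_le_colon (z := z ^+ n)) lenA _.
  apply: length_le_mem IHn => x; rewrite !inE => /predU1P[->|->].
    by rewrite eqxx.
  by rewrite !orbT.
move=> x; rewrite inE => /predU1P[->|Ax].
  by rewrite -exprSr; apply: sub_ideal_gen; rewrite /= mem_head.
apply: idealMl (ideal_gen_ideal _) _; apply: sub_ideal_gen.
by rewrite /= inE Ax orbT.
Qed.

Lemma length_le_expns B A r n : length_le (B ++ A) r ->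
  length_le ([seq y ^+ n | y <- B] ++ A) (n ^ size B * r).
Proof.
elim: B A r => [|z B IHB] A r lenA; first by rewrite mul1n.
rewrite /= expnS -mulnA; apply: length_le_expn.
have {IHB} : length_le ([seq y ^+ n | y <- B] ++ z :: A) (n ^ size B * r).
  apply: IHB; apply: length_le_mem lenA => x.
  by rewrite !(inE, mem_cat) orbCA.
by apply: length_le_mem => x; rewrite !(inE, mem_cat) orbCA.
Qed.

Lemma length_le_prime A : ideal_gen [set` A] = [set` P] -> length_le A 1.
Proof.
move=> AP n J Jsat Jdec AJ.
have PJ : [set` P] `<=` J n.
  by rewrite -AP; apply: ideal_gen_sub (Jsat n).1 _ => y; apply: AJ.
have {}PJ i : (i <= n)%N -> [set` P] `<=` J i.
  by move=> le_in x /PJ; apply: chain_sub.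
have JT i : J i 1 -> J i = setT.
  move=> Ji1; apply/seteqP; split=> // x _.
  by rewrite -[x]mulr1; apply: idealMl (Jsat i).1 Ji1.
have JP i : (i <= n)%N -> ~ J i 1 -> J i = [set` P].
  move=> le_in Ji1; apply/seteqP; split=> [x Jx|]; last exact: PJ.
  apply: contrapT => /negP xP; apply: Ji1.
  by apply: (Jsat i).2 xP _; rewrite mulr1.
(* Each [J i] is [P] or the unit ideal. The bound is sharpened for the induction: no drop has
   occurred while the last ideal is still the unit ideal. *)
suff: (\sum_(i < n) `[< J i <> J i.+1 >] <= ~~ `[< J n 1%R >])%N.
  by move/leq_trans; apply; case: `[< _ >].
elim: n PJ JP {AJ} => [|n IHn] PJ JP; first by rewrite big_ord0.
rewrite big_ord_recr /=.
have {IHn} := IHn (fun i le => PJ i (leqW le)) (fun i le => JP i (leqW le)).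
case: (asboolP (J n 1)) => Jn1 /=.
  rewrite leqn0 => /eqP->; rewrite add0n.
  case: asboolP => // Jne; case: asboolP => // /JT JnT.
  by case: Jne; rewrite JnT JT.
move=> le1; rewrite (_ : `[< J n.+1 1 >] = false); last first.
  by apply/asboolPn => /Jdec.
rewrite (_ : `[< _ >] = false) ?addn0 //.
by apply/asboolPn; apply; rewrite (JP n) // (JP n.+1) // => /Jdec.
Qed.

(** Locally the parameters contain the [c]-th powers of all generators of [P], for a common [c].
    Starting from length 1 for the residue field, raising the generators to the power [c] and then
    the parameters to the power [n] multiplies the bound by [c ^ size g] and [n ^ size x]. *)
Lemma parameters_length (x : seq R) : noetherian R ->
  {in x, forall y, y \in P} ->
  (forall Q : prime_idealr R, [set` Q] `<=` [set` P] -> {in x, forall y, y \in Q} ->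
      [set` Q] = [set` P]) ->
  exists L, forall n, length_le [seq y ^+ n | y <- x] (n ^ size x * L).
Proof.
move=> noeth xP xQ; have [g gP] := noeth _ (prime_ideal P).
have [c gc] : exists c, {in g, forall y, saturation (ideal_gen [set` x]) (y ^+ c)}.
  have {gP} : {in g, forall y, y \in P}.
    by move=> y yg; have : [set` P] y by rewrite gP; apply: sub_ideal_gen.
  elim: g => [|z g IHg] gP; first by exists 0%N.
  have [|c cg] := IHg; first by move=> y yg; apply: gP; rewrite inE yg orbT.
  have [n [u [uP ux]]] := parameters_radical noeth xQ (gP z (mem_head _ _)).
  have [Sid _] := saturation_saturated (ideal_gen_ideal [set` x]).
  exists (c + n)%N => y; rewrite inE exprD => /predU1P[->|yg].
    by apply: idealMl Sid _; exists u.
  by rewrite mulrC; apply: idealMl Sid _; apply: cg.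
have leng : length_le [seq y ^+ c | y <- g] (c ^ size g * 1).
  rewrite -[X in length_le X]cats0; apply: length_le_expns; rewrite cats0.
  exact/length_le_prime/esym.
exists (c ^ size g)%N => n; rewrite -[X in length_le X]cats0.
apply: length_le_expns; rewrite cats0 -[X in length_le _ X]muln1.
by apply: length_le_sub leng => _ /mapP[y yg ->]; apply: gc.
Qed.

End Length.

(** * Standard monomials *)

Lemma digit_sum_lt B G (u : 'I_G -> nat) : (forall i, u i < B)%N ->
  (\sum_(i < G) u i * B ^ i < B ^ G)%N.
Proof.
elim: G u => [|G IHG] u uB; first by rewrite big_ord0.
rewrite big_ord_recr /= expnS.
have := IHG (fun i => u (widen_ord (leqnSn G) i)) (fun i => uB _).
by have := uB ord_max; move: (B ^ G)%N (\sum_(i < G) _)%N (u _) => b s m; nia.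
Qed.

Lemma digit_sum_inj B G (u v : 'I_G -> nat) :
  (forall i, u i < B)%N -> (forall i, v i < B)%N ->
  (\sum_(i < G) u i * B ^ i = \sum_(i < G) v i * B ^ i)%N -> u =1 v.
Proof.
elim: G u v => [|G IHG] u v uB vB; first by move=> _ [].
rewrite !big_ord_recr /=.
have wu := digit_sum_lt (fun i => uB (widen_ord (leqnSn G) i)).
have wv := digit_sum_lt (fun i => vB (widen_ord (leqnSn G) i)).
move=> e; have /= e1 := congr1 (modn^~ (B ^ G)%N) e.
have /= e2 := congr1 (divn^~ (B ^ G)%N) e.
have B0 : (0 < B ^ G)%N by apply: leq_ltn_trans wu.
move: e1 e2; rewrite ![(_ + _ * _)%N]addnC !modnMDl !divnMDl // !divn_small //.
rewrite !addn0 !modn_small // => e1 e2 i.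
have [lt_iG|le_Gi] := ltnP i G.
  have -> : i = widen_ord (leqnSn G) (Ordinal lt_iG) by apply: val_inj.
  exact: (IHG _ _ _ _ e1).
suff -> : i = ord_max by [].
by apply/val_inj/anti_leq; rewrite /= le_Gi -ltnS ltn_ord.
Qed.

Section Monomials.
Variables (R : comNzRingType) (G : nat) (g : 'I_G -> R).
Implicit Types (a b c : 'I_G -> nat) (S : {pred 'I_G}).

Definition mon a : R := \prod_i g i ^+ a i.
Definition deg a : nat := (\sum_i a i)%N.

Lemma monD a b : mon (fun i => a i + b i)%N = mon a * mon b.
Proof. by rewrite -big_split /=; apply: eq_bigr => i _; rewrite exprD. Qed.

Lemma monM a n : mon (fun i => a i * n)%N = mon a ^+ n.
Proof. by rewrite -prodrXl; apply: eq_bigr => i _; rewrite exprM. Qed.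

Lemma degD a b : deg (fun i => a i + b i)%N = (deg a + deg b)%N.
Proof. exact: big_split. Qed.

Variable P : prime_idealr R.
Hypothesis gP : [set` P] = ideal_gen (range g).

Lemma mon_pow a : ideal_pow [set` P] (deg a) (mon a).
Proof.
rewrite /mon /deg; apply: (big_ind2 (fun (x : R) n => ideal_pow [set` P] n x)) => //.
  by move=> x m y n; apply: ideal_powD.
move=> i _; rewrite -[X in ideal_pow _ X]mul1n; apply: ideal_powX.
rewrite -[g i]mulr1; apply: ideal_mulM => //.
by rewrite gP; apply: sub_ideal_gen; exists i.
Qed.

Lemma pow_mon n :
  ideal_pow [set` P] n `<=` ideal_gen [set mon a | a in [set a | (n <= deg a)%N]].
Proof.
elim: n => [|n IHn].
  move=> x _; rewrite -[x]mulr1; apply: idealMl (ideal_gen_ideal _) _.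
  apply: sub_ideal_gen; exists (fun=> 0%N) => //.
  by rewrite /mon big1.
apply: ideal_genS => _ [x Px [y /IHn Iy <-]].
set K := ideal_gen _; have Kid : ideal K by apply: ideal_gen_ideal.
have Kgy z : ideal_gen [set mon a | a in [set a | (n <= deg a)%N]] z ->
    forall i, K (g i * z).
  move=> Iz i.
  have Kid' : ideal [set z | K (g i * z)].
    split=> [|c u v]; rewrite /mkset ?mulr0; first exact: ideal0.
    by rewrite mulrDr mulrCA; apply: Kid.2.
  move: z Iz; apply: (ideal_gen_sub Kid') => _ [a /= na <-].
  apply: sub_ideal_gen; exists (fun j => a j + (j == i))%N.
    by rewrite /= degD -[n.+1]addn1 leq_add // /deg (bigD1 i) //= eqxx.
  rewrite monD mulrC; congr (_ * _).
  by rewrite /mon (bigD1 i) //= eqxx big1 ?mulr1 // => j /negPf->.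
have Kid' : ideal [set x | K (x * y)].
  split=> [|c u v]; rewrite /mkset ?mul0r; first exact: ideal0.
  by rewrite mulrDl -mulrA; apply: Kid.2.
have {}Px : ideal_gen (range g) x by rewrite -gP.
by move: x Px; apply: (ideal_gen_sub Kid') => _ [i _ <-]; apply: Kgy.
Qed.

(** For [q] a power of the characteristic this is the Frobenius power of [I]. *)
Definition frobenius_pow (I : set R) q : set R := ideal_gen [set x ^+ q | x in I].

(** Divide the exponents by [q]: the quotients [b] give a factor [mon b ^+ q]. If [deg b] were at
    most [n], then, every remainder being less than [q], the exponents in [S] would total at most
    [q * (n + #|S|)]. *)
Lemma mon_frobenius_pow S a q n : (0 < q)%N ->
  (q * (n + #|S|) + \sum_(i | i \notin S) a i < deg a)%N ->
  frobenius_pow (ideal_pow [set` P] n.+1) q (mon a).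
Proof.
move=> q0 da; pose b i := (a i %/ q)%N; pose c i := (a i %% q)%N.
have -> : mon a = mon c * mon b ^+ q.
  by rewrite -monM -monD; apply: eq_bigr => i _; rewrite addnC -divn_eq.
apply: idealMl (ideal_gen_ideal _) _; apply: sub_ideal_gen.
exists (mon b) => //; apply: ideal_powS (mon_pow b).
rewrite ltnNge; apply/negP => nb; move: da; apply/negP; rewrite -leqNgt.
rewrite /deg (bigID (mem S)) /= leq_add2r.
apply: (@leq_trans (\sum_(i in S) (q * b i + q))%N).
  apply: leq_sum => i _; rewrite {1}(divn_eq (a i) q) mulnC leq_add2l.
  by rewrite ltnW // ltn_mod.
rewrite big_split /= sum_nat_const -big_distrr /= mulnDr [(#|_| * _)%N]mulnC.
rewrite leq_add2r leq_mul2l; apply/orP; right; apply: leq_trans nb.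
by rewrite /deg [X in (_ <= X)%N](bigID (mem S)) leq_addr.
Qed.

Variable B : nat.

(* Exponents below B are base-B digits, so weight is injective on a box. *)
Definition weight a : nat := (\sum_i a i * B ^ i)%N.

Lemma weightD a b : weight (fun i => a i + b i)%N = (weight a + weight b)%N.
Proof. by rewrite -big_split; apply: eq_bigr => i _; rewrite mulnDl. Qed.

Lemma weight_le a : (0 < B)%N -> (weight a <= deg a * B ^ G)%N.
Proof.
move=> B0; rewrite big_distrl leq_sum //= => i _.
by rewrite leq_mul2l leq_pexp2l ?orbT // ltnW.
Qed.

Definition higher d r : set ('I_G -> nat) :=
  [set a | (d < deg a)%N \/ deg a = d /\ (r <= weight a)%N].

Definition higher_ideal d r : set R :=
  saturation P (ideal_gen [set mon a | a in higher d r]).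

Lemma higher_ideal_saturated d r : saturated P (higher_ideal d r).
Proof. by apply: saturation_saturated; apply: ideal_gen_ideal. Qed.

Lemma higher_idealS d r d' r' : higher d r `<=` higher d' r' ->
  higher_ideal d r `<=` higher_ideal d' r'.
Proof.
move=> hh; apply: saturation_sub; first exact: higher_ideal_saturated.
move=> x Ix; apply: sub_saturation; move: x Ix; apply: ideal_genS => _ [a ha <-].
by apply: sub_ideal_gen; exists a => //; apply: hh.
Qed.

Definition standard a := ~ higher_ideal (deg a) (weight a).+1 (mon a).

(** Degree and weight are additive, so multiplication by the cofactor [mon c] turns a combination of
    monomials above [b] into one of monomials above [a]. *)
Lemma standard_le a b : (forall i, b i <= a i)%N -> standard a -> standard b.
Proof.
move=> ba stda [u uP Iub]; apply: stda; exists u => //.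
pose c i := (a i - b i)%N.
have ebc : a = (fun i => b i + c i)%N by apply/funext => i; rewrite /c subnKC.
rewrite ebc monD mulrA degD weightD.
have Kid (K : set R) : ideal K -> ideal [set x | K (x * mon c)].
  move=> Kid; split=> [|d x y]; rewrite /mkset ?mul0r; first exact: ideal0.
  by rewrite mulrDl -mulrA; apply: Kid.2.
move: (u * mon b) Iub; apply: (ideal_gen_sub (Kid _ (ideal_gen_ideal _))).
move=> _ [e he <-]; rewrite /mkset -monD; apply: sub_ideal_gen.
exists (fun i => e i + c i)%N => //.
case: he => [he|[he we]]; [left|right]; rewrite degD ?ltn_add2r //.
by rewrite he weightD -addSn leq_add2r.
Qed.

Lemma length_standard (x : seq R) L : (0 < B)%N -> {in x, forall y, y \in P} ->
  (forall n, length_le P [seq y ^+ n | y <- x] (n ^ size x * L)) ->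
  forall a, standard a ->
    (B ^ #|[pred i | (B <= a i)%N]| <= (G * B).+1 ^ size x * L)%N.
Proof.
move=> B0 xP lenx a stda; set S := [pred i | _]; set n := (G * B).+1.
(* Monomials in the box have degree below [n], and both their weight and its successor are below
   [K]. Hence a pair (degree, weight) can be coded as the single index degree times [K] plus
   weight. *)
pose K := (n * B ^ G).+2.
pose J i := higher_ideal (i %/ K) (i %% K).
have Jdec i : J i.+1 `<=` J i.
  apply: higher_idealS => b [lt_b|[db wb]].
    by left; apply: leq_ltn_trans lt_b; apply: leq_div2r.
  have := leq_div2r K (leqnSn i); rewrite leq_eqVlt => /orP[/eqP e|]; last first.
    by move=> ?; left; rewrite db.
  right; split; first by rewrite db.
  apply: leq_trans wb; have := divn_eq i K; have := divn_eq i.+1 K; lia.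
have Jsat i : saturated P (J i) by apply: higher_ideal_saturated.
have xJ : {in [seq y ^+ n | y <- x], forall y, J (n * K)%N y}.
  move=> _ /mapP[y /xP yP ->]; rewrite /J mulnK // modnMl.
  apply: sub_saturation.
  have /pow_mon : ideal_pow [set` P] n (y ^+ n).
    rewrite -[X in ideal_pow _ X]mul1n; apply: ideal_powX.
    by rewrite -[y]mulr1; apply: ideal_mulM.
  apply: ideal_genS => _ [b /= nb <-]; apply: sub_ideal_gen; exists b => //.
  by move: nb; rewrite leq_eqVlt => /orP[/eqP nb|nb]; [right|left].
apply: leq_trans (lenx n (n * K)%N J Jsat Jdec xJ).
pose p i := `[< J i <> J i.+1 >].
have -> : (\sum_(i < n * K) `[< J i <> J i.+1 >] =
           size [seq i <- iota 0 (n * K) | p i])%N.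
  transitivity (\sum_(0 <= i < n * K | p i) 1)%N.
    rewrite big_mkord [RHS]big_mkcond; apply: eq_bigr => i _.
    by rewrite /p; case: `[< _ >].
  by rewrite sum1_count size_filter /index_iota subn0.
pose B' := B.-1; have eB : B'.+1 = B by apply: prednK.
(* Exponents below [B] supported on [S]: these monomials divide [mon a], hence are standard, and
   each makes the chain [J] strict at its own index [idx f]. *)
pose box := pffun_on (ord0 : 'I_B'.+1) S predT.
have -> : (B ^ #|S| = #|box|)%N by rewrite card_pffun_on card_ord eB.
rewrite cardE.
pose u (f : {ffun 'I_G -> 'I_B'.+1}) i : nat := f i.
pose idx f := (deg (u f) * K + weight (u f))%N.
have ultn f i : (u f i < B)%N by rewrite -[in X in (_ < X)%N]eB; apply: ltn_ord.
have degu f : (deg (u f) < n)%N.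
  rewrite ltnS -[G in (G * _)%N]card_ord -sum_nat_const leq_sum // => i _.
  exact: ltnW.
have weightu f : ((weight (u f)).+1 < K)%N.
  rewrite !ltnS; apply: leq_trans (weight_le _ _) _ => //.
  by rewrite leq_mul2r ltnW ?orbT.
rewrite -(size_map idx); apply: uniq_leq_size.
  rewrite map_inj_uniq ?enum_uniq // => f f' e.
  apply/ffunP => i; apply: val_inj; move: i.
  apply: (digit_sum_inj (ultn f) (ultn f')).
  have := congr1 (modn^~ K) e; rewrite /idx !modnMDl.
  rewrite !(modn_small (ltnW (weightu _))) => ew.
  exact: ew.
move=> _ /mapP[f /[!mem_enum] /pffun_onP[fS _] ->].
rewrite mem_filter mem_iota add0n /=; apply/andP; split; last first.
  apply: (@leq_trans ((deg (u f)).+1 * K)); last by rewrite leq_mul2r degu orbT.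
  by have := weightu f; rewrite mulSn /idx; lia.
have stdu : standard (u f).
  apply: standard_le stda => i; have [Si|nSi] := boolP (i \in S).
    by apply: ltnW; apply: leq_trans (ultn f i) _; move: Si; rewrite inE.
  suff -> : u f i = 0%N by [].
  apply/eqP; apply: contraNT nSi => ui; apply: (fintype.subsetP fS).
  by rewrite inE; apply: contra ui => /eqP fi; rewrite /u fi.
apply/asboolP => e; apply: stdu.
have : J (idx f) (mon (u f)).
  apply: sub_saturation; apply: sub_ideal_gen; exists (u f) => //; right.
  by rewrite /idx divnMDl // modnMDl (divn_small (ltnW (weightu f))) addn0 leq_mod.
rewrite e; apply: higher_idealS => b.
rewrite /idx -addnS divnMDl // modnMDl (divn_small (weightu f)) addn0.
by rewrite (modn_small (weightu f)).
Qed.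

(** A nonstandard monomial is rewritten locally through higher ones, whose degree is no smaller.
    This ends either at standard monomials, with at most [h] exponents reaching [B] and the others
    totalling at most [G * B], or at degrees so large that [mon_frobenius_pow] applies with all
    indices in [S]. *)
Lemma mon_saturation h q n a : (0 < B)%N -> (0 < q)%N ->
  (forall b, standard b -> (#|[pred i | (B <= b i)%N]| <= h)%N) ->
  (q * (n + h) + G * B < deg a)%N ->
  saturation P (frobenius_pow (ideal_pow [set` P] n.+1) q) (mon a).
Proof.
move=> B0 q0 stdh; set Q := frobenius_pow _ _.
(* From degree [D] on there is nothing left to rewrite. Below it weights are less than [K], so
   degree times [K] plus weight strictly increases under rewriting, and [d] bounds what it lacks to
   [D * K]. *)
pose D := (q * (n + G)).+1; pose K := (D * B ^ G).+1.
have Qsat : saturated P (saturation P Q).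
  by apply: saturation_saturated; apply: ideal_gen_ideal.
have [d] : exists d, (D * K <= deg a * K + weight a + d)%N.
  by exists (D * K)%N; apply: leq_addl.
elim: d a => [|d IHd] a Da ha.
all: have [Da'|aD] := leqP D (deg a).
- apply: sub_saturation; apply: (@mon_frobenius_pow predT) => //.
  by rewrite card_ord big_pred0 ?addn0.
- have := weight_le a B0; have : (deg a * B ^ G <= D * B ^ G)%N.
    by rewrite leq_mul2r ltnW ?orbT.
  have : ((deg a).+1 * K <= D * K)%N by rewrite leq_mul2r aD orbT.
  by move: Da; rewrite addn0 mulSn /K; lia.
- apply: sub_saturation; apply: (@mon_frobenius_pow predT) => //.
  by rewrite card_ord big_pred0 ?addn0.
have [stda|/contrapT] := pselect (standard a).
  apply: sub_saturation; apply: (@mon_frobenius_pow [pred i | (B <= a i)%N]) => //.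
  apply: leq_ltn_trans ha; apply: leq_add.
    by rewrite leq_mul2l leq_add2l stdh ?orbT.
  rewrite -[G in (G * _)%N]card_ord -sum_nat_const big_mkcond leq_sum // => i _.
  by rewrite !inE -ltnNge; case: ltnP => // /ltnW.
apply: saturation_sub => // x; apply: (ideal_gen_sub Qsat.1) => _ [b hb <-].
have wa : (weight a < K)%N.
  rewrite ltnS; apply: leq_trans (weight_le a B0) _.
  by rewrite leq_mul2r ltnW ?orbT.
apply: IHd; last by apply: (leq_trans ha); case: hb => [/ltnW//|[->]].
apply: leq_trans Da _; rewrite addnS -addSn leq_add2r.
case: hb => [ab|[-> wb]]; last by rewrite -addnS leq_add2l.
apply: (@leq_trans ((deg a).+1 * K)); first by rewrite mulSn -addnS addnC leq_add2r.
by apply: leq_trans (leq_addr _ _); rewrite leq_mul2r ab orbT.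
Qed.

End Monomials.

Lemma few_large_exponents (R : comNzRingType) G (g : 'I_G -> R)
    (P : prime_idealr R) (x : seq R) L :
  [set` P] = ideal_gen (range g) -> {in x, forall y, y \in P} ->
  (forall n, length_le P [seq y ^+ n | y <- x] (n ^ size x * L)) ->
  exists2 B, (0 < B)%N & forall a, standard g P B a ->
    (#|[pred i | (B <= a i)%N]| <= size x)%N.
Proof.
(* Since [G * B + 1] is at most [2 * G * B], more than [size x] large exponents would give
   [B ^ (size x + 1)] at most [B ^ size x * ((2 * G) ^ size x * L)]; this [B] is one too large for
   that. *)
move=> gP xP lenx; pose B := ((2 * G) ^ size x * L).+1.
exists B => // a /(length_standard gP (ltn0Sn _ : 0 < B)%N xP lenx).
set s := #|_| => leB; case: (leqP s (size x)) => // lt_xs.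
have G0 : (0 < G)%N.
  by have := leq_trans lt_xs (max_card _); rewrite card_ord; apply: leq_ltn_trans.
suff : (B ^ (size x).+1 <= B ^ size x * B.-1)%N.
  by rewrite expnSr leq_pmul2l ?expn_gt0 // ltnn.
apply: leq_trans (_ : B ^ (size x).+1 <= B ^ s)%N (leq_trans leB _).
  exact: leq_pexp2l.
rewrite [B.-1]/= mulnA -expnMn leq_mul2r; apply/orP; right.
have le_GB : ((G * B).+1 <= B * (2 * G))%N by rewrite /B; nia.
by case: (size x) => // n; rewrite leq_exp2r.
Qed.

Lemma frobenius_pow_prime (R : comNzRingType) (P : prime_idealr R) h :
  noetherian R -> has_height P h ->
  exists C, forall q n M, (0 < q)%N -> (q * (n + h) + C < M)%N ->
    ideal_pow [set` P] M `<=`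
      saturation P (frobenius_pow (ideal_pow [set` P] n.+1) q).
Proof.
move=> noeth Ph.
have [x [<- xP xQ]] := height_parameters noeth Ph.
have [L lenx] := parameters_length noeth xP xQ.
have [s sP] := noeth _ (prime_ideal P).
pose g (i : 'I_(size s)) := s`_i.
have gP : [set` P] = ideal_gen (range g).
  rewrite sP; congr ideal_gen; apply/seteqP; split=> [y /= ys|_ [i _ <-]].
    have lt_i : (index y s < size s)%N by rewrite index_mem.
    by exists (Ordinal lt_i) => //; rewrite /g /= nth_index.
  exact: mem_nth.
have [B B0 fewB] := few_large_exponents gP xP lenx.
exists (size s * B)%N => q n M q0 ltM y /(pow_mon gP); apply: ideal_gen_sub.
  exact: (saturation_saturated P (ideal_gen_ideal _)).1.
move=> _ [a /= Ma <-]; apply: mon_saturation fewB _ => //; exact: leq_trans Ma.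
Qed.

(** * Contractions of the tensor square *)

Section SeparatingFunctional.
Variables (k : fieldType) (V : lmodType k).
Implicit Types (H : set V) (s : seq V).

Definition functional (f : V -> k) := forall c x y, f (c *: x + y) = c * f x + f y.

Definition lin_span s : set V :=
  [set x | exists c : nat -> k, x = \sum_(i < size s) c i *: s`_i].

(** A subspace [H] maximal among those containing [s] and missing [y] is a hyperplane complementary
    to the line of [y]; the functional is the coordinate along [y]. *)
Lemma separating_functional s (y : V) : ~ lin_span s y ->
  exists2 f, functional f & f y = 1 /\ {in s, forall x, f x = 0}.
Proof.
move=> ys.
pose good H := [/\ H 0, forall c x z, H x -> H z -> H (c *: x + z),
  {in s, forall x, H x} & ~ H y].
have [|H [H0' maxH]] := @Zorn_bigcup V (good `|` [set set0]).
  move=> F Fgood totF.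
  have [[J FJ J0]|noJ] := pselect (exists2 J, F J & J !=set0); last first.
    right; apply/seteqP; split=> // x [J FJ Jx].
    by apply: noJ; exists J => //; exists x.
  have Fg K x : F K -> K x -> good K by move=> /Fgood[//|->].
  have [x Jx] := J0; have [J00 JL Js Jy] := Fg J x FJ Jx.
  left; split.
  - by exists J.
  - move=> c u v [K FK Ku] [L FL Lv].
    have [KL|LK] := totF _ _ FK FL.
      exists L => //; have [_ LL _ _] := Fg L v FL Lv.
      by apply: LL => //; apply: KL.
    exists K => //; have [_ KL _ _] := Fg K u FK Ku.
    by apply: KL => //; apply: LK.
  - by move=> u /Js Ju; exists J.
  - by move=> [K FK Ky]; have [] := Fg K y FK Ky.
have span_good : good (lin_span s).
  split=> //.
  - by exists (fun=> 0); rewrite big1 // => i _; rewrite scale0r.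
  - move=> c _ _ [d ->] [e ->]; exists (fun i => c * d i + e i).
    rewrite scaler_sumr -big_split; apply: eq_bigr => i _.
    by rewrite /= scalerDl scalerA.
  - move=> x xs; exists (fun i => (i == index x s)%:R).
    have lt_x : (index x s < size s)%N by rewrite index_mem.
    rewrite (bigD1 (Ordinal lt_x)) //= eqxx scale1r nth_index // big1 ?addr0 //.
    by move=> i; rewrite -val_eqE /= => /negPf->; rewrite scale0r.
have [H0 HL Hs Hy] : good H.
  case: H0' => // H0'; exfalso; apply: (maxH (lin_span s)); last by left.
  by rewrite H0'; split=> // /(_ 0); apply; case: span_good.
have HZ c x : H x -> H (c *: x) by move=> Hx; rewrite -[_ *: _]addr0; apply: HL.
have dec x : exists c, H (x - c *: y).
  have [Hx|Hx] := pselect (H x); first by exists 0; rewrite scale0r subr0.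
  (* By maximality the span of [H] and [x] contains [y]. The coefficient of [x] in [y] is nonzero
     because [y] is not in [H], so one can solve for [x]. *)
  pose K := [set z | exists c w, H w /\ z = c *: x + w].
  have KH : H `<` K.
    split=> [w Hw|KH]; first by exists 0, w; rewrite scale0r add0r.
    by apply: Hx; apply: KH; exists 1, 0; rewrite scale1r addr0.
  have Ky : K y.
    apply: contrapT => Ky; apply: (maxH K KH); left; split=> //.
    - by exists 0, 0; rewrite scale0r addr0.
    - move=> c _ _ [d [u [Hu ->]]] [e [v [Hv ->]]].
      exists (c * d + e), (c *: u + v); split; first exact: HL.
      by rewrite scalerDr scalerA scalerDl addrACA.
    - by move=> z /Hs Hz; apply: KH.1.
  have [c [w [Hw e]]] := Ky.
  have c0 : c != 0.
    by apply/eqP => c0; apply: Hy; rewrite e c0 scale0r add0r.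
  exists c^-1; rewrite e scalerDr scalerA mulVf // scale1r opprD addNKr.
  by rewrite -scaleNr; apply: HZ.
have [f fH] := choice dec.
have uniq_f x c : H (x - c *: y) -> f x = c.
  move=> Hxc; apply/eqP; rewrite -subr_eq0; apply: contrapT => /negP fc0; apply: Hy.
  rewrite -[y]scale1r -(mulVf fc0) -scalerA; apply: HZ.
  rewrite (_ : _ *: y = - 1 *: (x - f x *: y) + (x - c *: y)); first exact: HL.
  by rewrite scaleN1r opprB scalerBl addrA subrK.
exists f => [c x z|].
  apply: uniq_f; rewrite scalerDl -scalerA opprD addrACA -scalerBr.
  exact: HL.
split; first by apply: uniq_f; rewrite scale1r subrr.
by move=> x xs; apply: uniq_f; rewrite scale0r subr0; apply: Hs.
Qed.

Lemma functionalD f x y : functional f -> f (x + y) = f x + f y.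
Proof. by move=> ff; rewrite -[x]scale1r ff mul1r scale1r. Qed.

Lemma functionalZ f c x : functional f -> f (c *: x) = c * f x.
Proof.
move=> ff; have f0 : f 0 = 0.
  by apply: (addIr (f 0)); rewrite -functionalD // !add0r.
by rewrite -[_ *: _]addr0 ff f0 addr0.
Qed.

End SeparatingFunctional.

Section TensorContraction.
Variables (k : fieldType) (R : comAlgType k).
Local Notation T := (tensor2 R).

Section Balanced.
Variables (V : zmodType) (beta : R -> R -> V).
Hypothesis betaDl : forall x x' y, beta (x + x') y = beta x y + beta x' y.
Hypothesis betaDr : forall x y y', beta x (y + y') = beta x y + beta x y'.
Hypothesis betaZ : forall c x y, beta (c *: x) y = beta x (c *: y).

(** The additive map that the universal property attaches to the balanced map [beta]; [contractionE]
    shows independence of the representative. *)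
Definition contraction (t : T) : V := \sum_(z <- repr t) beta z.1 z.2.

Lemma contractionE s : contraction (tsum s) = \sum_(z <- s) beta z.1 z.2.
Proof.
rewrite /contraction; move: (repr _) (tsum_repr s) => u; elim=> {u s} //.
- by move=> t s' u _ -> _ ->.
- by move=> u u' t t' _ h1 _ h2; rewrite !big_cat h1 h2.
- by move=> t u h; apply: perm_big.
- move=> y; rewrite big_seq1 big_nil /=.
  by apply: (addIr (beta 0 y)); rewrite -betaDl !add0r.
- by move=> x x' y; rewrite !big_cons !big_nil /= !addr0 betaDl.
- by move=> x y y'; rewrite !big_cons !big_nil /= !addr0 betaDr.
- by move=> c x y; rewrite !big_seq1 betaZ.
Qed.

End Balanced.

Lemma tpureM (x y x' y' : R) : tpure x y * tpure x' y' = tpure (x * x') (y * y') :> T.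
Proof. by rewrite [LHS](_ : _ = tensor_mul (tpure x y) (tpure x' y')) // tensor_mulE. Qed.

Lemma tsum_cons x y (s : seq (R * R)) : tsum ((x, y) :: s) = tpure x y + tsum s :> T.
Proof. by rewrite [RHS](_ : _ = tensor_add (tpure x y) (tsum s)) // tensor_addE. Qed.

Lemma tpureDl x x' y : tpure (x + x') y = tpure x y + tpure x' y :> T.
Proof. by rewrite -tsum_cons; apply/tsum_eqP; apply: tensor_Dl. Qed.

Lemma tpureDr x y y' : tpure x (y + y') = tpure x y + tpure x y' :> T.
Proof. by rewrite -tsum_cons; apply/tsum_eqP; apply: tensor_Dr. Qed.

Lemma tpureZ (c : k) x y : tpure (c *: x) y = tpure x (c *: y) :> T.
Proof. by apply/tsum_eqP; apply: tensor_Z. Qed.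

Local Notation swap := (fun z : R * R => (z.2, z.1)).

Lemma tensor_eq_swap (s t : seq (R * R)) :
  tensor_eq s t -> tensor_eq (map swap s) (map swap t).
Proof.
elim=> {s t} /=.
- by move=> s; apply: tensor_refl.
- by move=> s t _; apply: tensor_sym.
- by move=> t s u _ h1 _; apply: tensor_trans.
- by move=> s s' t t' _ h1 _ h2; rewrite !map_cat; apply: tensor_cat.
- by move=> s t h; apply: tensor_perm; apply: perm_map.
(* Only a zero first component is killed by a defining relation; a zero second component is brought
   to that case by moving the scalar 0 across. *)
- move=> y; apply: tensor_trans (tensor_0l y); rewrite -(scale0r (0 : R)).
  apply: tensor_trans (tensor_sym (tensor_Z _ _ _)) _.
  by rewrite !scale0r; apply: tensor_trans (tensor_0l _) (tensor_sym (tensor_0l _)).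
- by move=> x x' y; apply: tensor_Dr.
- by move=> x y y'; apply: tensor_Dl.
- by move=> c x y; apply/tensor_sym/tensor_Z.
Qed.

Lemma tsum_swap (s t : seq (R * R)) :
  tsum s = tsum t :> T -> tsum (map swap s) = tsum (map swap t) :> T.
Proof. by move=> /tsum_eqP h; apply/tsum_eqP; apply: tensor_eq_swap. Qed.

Definition contractl (f : R -> k) : T -> R := contraction (fun x y => f y *: x).
Definition contractr (f : R -> k) : T -> R := contraction (fun x y => f x *: y).

Section Functional.
Variable f : R -> k.
Hypothesis ff : functional f.

Lemma contractlE s : contractl f (tsum s) = \sum_(z <- s) f z.2 *: z.1.
Proof.
apply: contractionE => [x x' y|x y y'|c x y]; first exact: scalerDr.
  by rewrite functionalD // scalerDl.
by rewrite functionalZ // scalerA mulrC.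
Qed.

Lemma contractrE s : contractr f (tsum s) = \sum_(z <- s) f z.1 *: z.2.
Proof.
apply: contractionE => [x x' y|x y y'|c x y]; last 1 first.
- by rewrite functionalZ // scalerA mulrC.
- by rewrite functionalD // scalerDl.
exact: scalerDr.
Qed.

Lemma contractlD t u : contractl f (t + u) = contractl f t + contractl f u.
Proof.
have [[s ->] [s' ->]] := conj (tsumP t) (tsumP u).
rewrite [X in contractl _ X](_ : _ = tensor_add (tsum s) (tsum s')) //.
by rewrite tensor_addE !contractlE big_cat.
Qed.

Lemma contractrD t u : contractr f (t + u) = contractr f t + contractr f u.
Proof.
have [[s ->] [s' ->]] := conj (tsumP t) (tsumP u).
rewrite [X in contractr _ X](_ : _ = tensor_add (tsum s) (tsum s')) //.
by rewrite tensor_addE !contractrE big_cat.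
Qed.

Lemma contractlM r t : contractl f (tpure r 1 * t) = r * contractl f t.
Proof.
have [s ->] := tsumP t.
rewrite [X in contractl _ X](_ : _ = tensor_mul (tpure r 1) (tsum s)) //.
rewrite tensor_mulE pre_mul_map !contractlE big_map mulr_sumr.
by apply: eq_bigr => z _ /=; rewrite mul1r scalerAr.
Qed.

Lemma contractrM r t : contractr f (tpure 1 r * t) = r * contractr f t.
Proof.
have [s ->] := tsumP t.
rewrite [X in contractr _ X](_ : _ = tensor_mul (tpure 1 r) (tsum s)) //.
rewrite tensor_mulE pre_mul_map !contractrE big_map mulr_sumr.
by apply: eq_bigr => z _ /=; rewrite mul1r scalerAr.
Qed.

End Functional.

(** Each scalar [c i] moves to the first factor, where [c i *: x] is absorbed by the [i]-th summand.
    The second components of [s] are kept, so conditions on them survive. *)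
Lemma tsum_eliminate (c : nat -> k) x (s : seq (R * R)) :
  tsum ((x, \sum_(i < size s) c i *: (s`_i).2) :: s) =
  tsum [seq ((s`_i).1 + c i *: x, (s`_i).2) | i <- iota 0 (size s)] :> T.
Proof.
have T0 : 0 = tsum [::] :> T by [].
rewrite tsum_cons; elim: s c => [|[a b] s IHs] c /=.
  rewrite big_ord0 -T0 addr0 T0; apply/tsum_eqP; rewrite -(scale0r (0 : R)).
  apply: tensor_trans (tensor_sym (tensor_Z _ _ _)) _.
  by rewrite scale0r; apply: tensor_0l.
rewrite big_ord_recl /= !tsum_cons tpureDr addrACA tpureDl tpureZ.
rewrite [tpure a b + _]addrC; congr (_ + _).
rewrite (iotaDl 1 0) -map_comp (IHs (fun i => c i.+1)).
by congr tsum; apply: eq_map => i.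
Qed.

(* If the second components are linearly independent, contracting against a dual
   functional isolates a first component; otherwise one summand is eliminated. *)
Lemma tsum_components (I J : set R) (s : seq (R * R)) :
  ideal I -> {in s, forall z, J z.2} ->
  (forall f, functional f -> I (contractl f (tsum s))) ->
  exists2 s', tsum s = tsum s' :> T & {in s', forall z, I z.1 /\ J z.2}.
Proof.
move=> Iid; move: {2}(size s) (leqnn (size s)) => n.
elim: n s => [|n IHn] [|[x y] s] //= sn sJ sI; try by exists [::].
have [[c yc]|ys] := pselect (lin_span (map snd s) y).
  set s1 := [seq ((s`_i).1 + c i *: x, (s`_i).2) | i <- iota 0 (size s)].
  have es : tsum ((x, y) :: s) = tsum s1 :> T.
    rewrite -tsum_eliminate yc size_map; congr (tsum ((_, _) :: _)).
    by apply: eq_bigr => i _; rewrite (nth_map 0).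
  rewrite es in sI *; apply: IHn => //; first by rewrite size_map size_iota.
  move=> _ /mapP[i /[!mem_iota] /= lt_i ->] /=.
  by apply: (sJ s`_i); rewrite inE mem_nth ?orbT.
have [f ff [fy fs]] := separating_functional ys.
have Ix : I x.
  have := sI f ff; rewrite contractlE // big_cons fy scale1r big_seq big1 ?addr0 //.
  by move=> z zs; rewrite fs ?scale0r //; apply: map_f.
have [|z zs|f' ff'|s' es s'P] := IHn s => //.
- by apply: (sJ z); rewrite inE zs orbT.
- have := sI f' ff'; rewrite !contractlE // big_cons /= => If'.
  rewrite -(addKr (f' y *: x) (\sum_(_ <- _) _)) addrC; apply: idealB => //.
  by rewrite -[x]mul1r scalerAl; apply: idealMl.
exists ((x, y) :: s'); first by rewrite !tsum_cons es.
move=> z; rewrite inE => /predU1P[->|/s'P//]; split=> //.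
exact: (sJ (x, y) (mem_head _ _)).
Qed.

(** Two passes of [tsum_components]: the first brings the first components into [I]; the second,
    with the factors swapped, brings the others into [J] while staying in [I]. *)
Lemma tensor_mu_components (I J : set R) (t : T) : ideal I -> ideal J ->
  (forall f, functional f -> I (contractl f t)) ->
  (forall f, functional f -> J (contractr f t)) ->
  ideal_mul I J (tensor_mu t).
Proof.
move=> Iid Jid It Jt; have [s es] := tsumP t; rewrite {}es in It Jt *.
have [//|s1 es1 s1P] := tsum_components (J := setT) Iid (s := s) _ It.
rewrite es1 in Jt *.
have [z|f ff|s2 es2 s2P] := tsum_components (J := I) Jid (s := map swap s1).
- by move=> /mapP[z' /s1P[Iz _] ->].
- by have := Jt f ff; rewrite contractlE // contractrE // big_map.
have {}es2 : tsum s1 = tsum (map swap s2) :> T.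
  rewrite -(tsum_swap es2) -map_comp; congr tsum.
  by rewrite map_id_in // => -[].
rewrite es2 tensor_muE big_map big_seq.
have IJid : ideal (ideal_mul I J) by apply: ideal_gen_ideal.
apply: (big_ind (ideal_mul I J)) => [|x y|z /s2P[Jz Iz]].
- exact: ideal0.
- exact: idealD.
exact: ideal_mulM.
Qed.

End TensorContraction.

(** * Symbolic powers *)

Lemma symbolic_powerE (R : comNzRingType) (P : prime_idealr R) n :
  symbolic_power P n = saturation P (ideal_pow [set` P] n).
Proof.
set W := prime_compl P; apply/seteqP; split=> x.
  (* The fractions with some numerator in the saturation form an ideal containing the extended
     power. *)
  pose K := [set z : loc W | exists a w, z = Defs.frac a w /\
                 saturation P (ideal_pow [set` P] n) a].
  have [Sid Ssat] := saturation_saturated P (ideal_pow_ideal [set` P] n).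
  have Kid : ideal K.
    split; first by exists 0, (denom1 W); split=> //; apply: ideal0.
    move=> z _ _ [a [v [-> Sa]]] [b [w [-> Sb]]].
    have [c [u ->]] := Defs.fracP z.
    exists (c * a * sval w + b * (sval u * sval v)), (denomM (denomM u v) w).
    split.
      rewrite [LHS](_ : _ =
        loc_add (loc_mul (Defs.frac c u) (Defs.frac a v)) (Defs.frac b w)) //.
      by rewrite loc_mulE loc_addE.
    by apply: idealD => //; rewrite mulrC; apply: idealMl => //; apply: idealMl.
  have KP : to_loc W @` ideal_pow [set` P] n `<=` K.
    by move=> _ [a Pa <-]; exists a, (denom1 W); split=> //; apply: sub_saturation.
  move=> /(ideal_gen_sub Kid KP) [a [w [/frac_eqP[u uP e] Sa]]].
  apply: (Ssat u) => //; apply: (Ssat (sval w)); first exact: (svalP w).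
  rewrite mulrCA [sval w * x]mulrC e /= mulr1.
  exact: idealMl.
move=> [u uP Pux]; have uW : u \in W by []; rewrite /symbolic_power /preimage /mkset.
have -> : to_loc W x = Defs.frac 1 (exist _ u uW) * to_loc W (u * x).
  rewrite [RHS](_ : _ = loc_mul (Defs.frac 1 (exist _ u uW)) (to_loc W (u * x))) //.
  by rewrite loc_mulE; apply: frac_eq => /=; ring.
apply: idealMl (ideal_gen_ideal _) _; apply: sub_ideal_gen.
by exists (u * x).
Qed.

(** * Inverse-Frobenius-linear maps and the containments *)

Section PInverseLinear.
Variables (A : comNzRingType) (q : nat) (phi : A -> A).
Hypothesis phiD : forall x y, phi (x + y) = phi x + phi y.
Hypothesis phiM : forall r x, phi (r ^+ q * x) = r * phi x.

Lemma iter_additive n x y : iter n phi (x + y) = iter n phi x + iter n phi y.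
Proof. by elim: n => //= n ->. Qed.

Lemma iter_pinv_linear n r x : iter n phi (r ^+ (q ^ n) * x) = r * iter n phi x.
Proof. by elim: n r => [|n IHn] r; rewrite ?expr1 // expnS exprM /= IHn. Qed.

End PInverseLinear.

(** [Phi] takes [q]-th roots of scalars: a generator [z ^+ q] with [z] in [I] leaves [Phi] as
    [iota z] and then leaves [rho] as [z]. In use, [iota] embeds one tensor factor and [rho]
    contracts the other. *)
Lemma pinv_linear_saturation (R T : comNzRingType) (P : prime_idealr R) (I : set R)
    (q : nat) (Phi : T -> T) (iota : R -> T) (rho : T -> R) (w : T) (y : R) :
  (0 < q)%N ->
  (forall t u, Phi (t + u) = Phi t + Phi u) ->
  (forall t u, Phi (t ^+ q * u) = t * Phi u) ->
  {morph iota : x z / x + z} -> {morph iota : x z / x * z} -> iota 1 = 1 ->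
  {morph rho : t u / t + u} -> (forall r t, rho (iota r * t) = r * rho t) ->
  ideal I -> saturation P (frobenius_pow I q) y ->
  saturation P I (rho (Phi (iota y * w))).
Proof.
move=> q0 PhiD PhiM iotaD iotaM iota1 rhoD rhoM Iid [u uP Quy].
have iotaX r n : iota (r ^+ n) = iota r ^+ n.
  by elim: n => // n IHn; rewrite !exprS iotaM IHn.
(* The multiplier [r] is built in because [Phi] is not linear, so that [K] is an ideal. *)
pose K := [set v | forall r, I (rho (Phi (iota (r * v) * w)))].
have Kid : ideal K.
  have iota0 : iota 0 = 0 by apply: (addIr (iota 0)); rewrite -iotaD !add0r.
  have Phi0 : Phi 0 = 0 by apply: (addIr (Phi 0)); rewrite -PhiD !add0r.
  have rho0 : rho 0 = 0 by apply: (addIr (rho 0)); rewrite -rhoD !add0r.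
  split=> [r|a v z Kv Kz r].
    by rewrite mulr0 iota0 mul0r Phi0 rho0; apply: ideal0.
  by rewrite mulrDr mulrA iotaD mulrDl PhiD rhoD; apply: idealD.
have QK : frobenius_pow I q `<=` K.
  apply: (ideal_gen_sub Kid) => _ [z Iz <-] r.
  rewrite [r * _]mulrC iotaM iotaX -mulrA PhiM rhoM mulrC.
  exact: idealMl.
(* The denominator [u] enters [Phi] as [u ^+ q], that is, as [u ^+ q.-1] times the [u] that carries
   [y] into the Frobenius power. *)
exists u => //; rewrite -rhoM -PhiM -iotaX mulrA -iotaM -(prednK q0) exprSr -mulrA.
exact: QK.
Qed.

Section DiagonalSplitting.
Variables (k : fieldType) (R : comAlgType k) (q : nat).
Variables (phi : R -> R) (Phi : tensor2 R -> tensor2 R).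
Hypothesis q_gt1 : (1 < q)%N.
Hypothesis phiM : forall r x, phi (r ^+ q * x) = r * phi x.
Hypothesis phi1 : phi 1 = 1.
Hypothesis PhiD : forall t u, Phi (t + u) = Phi t + Phi u.
Hypothesis PhiM : forall t u, Phi (t ^+ q * u) = t * Phi u.
Hypothesis mu_Phi : forall t, tensor_mu (Phi t) = phi (tensor_mu t).

Lemma mu_iter_Phi n t : tensor_mu (iter n Phi t) = iter n phi (tensor_mu t).
Proof. by elim: n => //= n <-. Qed.

Lemma symbolic_power_mul (P : prime_idealr R) h a b N :
  noetherian R -> has_height P h -> (a + b + 2 * h < N)%N ->
  symbolic_power P N `<=`
    ideal_mul (symbolic_power P a.+1) (symbolic_power P b.+1).
Proof.
move=> noeth Ph abN x; rewrite !symbolic_powerE => -[u uP PNux].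
have [C frobP] := frobenius_pow_prime noeth Ph.
(* The hypothesis on [N] leaves a slack of [Q] in [N * Q]; it must exceed one [C] for each factor
   and at most [N] from rounding in [i]. *)
pose n := (2 * C + N)%N; pose Q := (q ^ n)%N.
have ltQ : (2 * C + N < Q)%N by apply: ltn_expl.
have Q0 : (0 < Q)%N by apply: leq_ltn_trans ltQ.
(* The least exponent for which [frobP] applies to the first factor, which leaves as much as
   possible in [Q - i] for the second. *)
pose i := ((Q * (a + h) + C) %/ N).+1.
have N0 : (0 < N)%N by apply: leq_ltn_trans abN.
have iN : (Q * (a + h) + C < N * i)%N by rewrite [(N * i)%N]mulnC ltn_ceil.
have Ni : (N * i <= Q * (a + h) + C + N)%N.
  by rewrite mulnS addnC leq_add2r [(N * _)%N]mulnC leq_divM.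
have QN : (Q * (a + b + 2 * h) + Q <= N * Q)%N.
  by rewrite -mulnSr [(N * Q)%N]mulnC leq_mul2l abN orbT.
have iQ : (i <= Q)%N.
  rewrite -(leq_pmul2l N0); nia.
have jN : (Q * (b + h) + C < N * (Q - i))%N by rewrite mulnBr; nia.
have satX c m : (Q * (c + h) + C < N * m)%N ->
    saturation P (frobenius_pow (ideal_pow [set` P] c.+1) Q) (x ^+ m).
  move=> cm; have [_ Ssat] := saturation_saturated P
    (ideal_gen_ideal [set y ^+ Q | y in ideal_pow [set` P] c.+1]).
  apply: (Ssat (u ^+ m)); first exact: prime_notinX.
  rewrite -exprMn; apply: (frobP Q c (N * m)%N Q0 cm).
  exact: ideal_powX.
pose t := iter n Phi (tpure (x ^+ i) (x ^+ (Q - i))).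
have <- : tensor_mu t = x.
  rewrite /t mu_iter_Phi tensor_mu_pure -exprD subnKC // -[x ^+ Q]mulr1.
  rewrite (iter_pinv_linear phiM) (_ : iter n phi 1 = 1) ?mulr1 //.
  by elim: (n) => //= m ->.
have idS c := (saturation_saturated P (ideal_pow_ideal [set` P] c)).1.
apply: tensor_mu_components => // f ff.
- rewrite /t (_ : tpure _ _ = tpure (x ^+ i) 1 * tpure 1 (x ^+ (Q - i))); last first.
    by rewrite tpureM mulr1 mul1r.
  apply: (@pinv_linear_saturation R _ P _ Q (iter n Phi) (fun r => tpure r 1)) => //.
  + exact: iter_additive.
  + exact: iter_pinv_linear.
  + by move=> y z; apply: tpureDl.
  + by move=> y z; rewrite tpureM mulr1.
  + by move=> y z; apply: contractlD.
  + by move=> r y; apply: contractlM.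
  + exact: ideal_pow_ideal.
  + exact: satX.
- rewrite /t (_ : tpure _ _ = tpure 1 (x ^+ (Q - i)) * tpure (x ^+ i) 1); last first.
    by rewrite tpureM mulr1 mul1r.
  apply: (@pinv_linear_saturation R _ P _ Q (iter n Phi) (fun r => tpure 1 r)) => //.
  + exact: iter_additive.
  + exact: iter_pinv_linear.
  + by move=> y z; apply: tpureDr.
  + by move=> y z; rewrite tpureM mulr1.
  + by move=> y z; apply: contractrD.
  + by move=> r y; apply: contractrM.
  + exact: ideal_pow_ideal.
  + exact: satX.
Qed.

End DiagonalSplitting.

(** Taking [a = 0] peels off one first symbolic power, contained in [P], at the cost of lowering the
    exponent by [2 * h]. *)
Lemma symbolic_power_double (R : comNzRingType) (P : prime_idealr R) h :
  (0 < h)%N ->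
  (forall a b N, (a + b + 2 * h < N)%N -> symbolic_power P N `<=`
    ideal_mul (symbolic_power P a.+1) (symbolic_power P b.+1)) ->
  forall n, symbolic_power P (2 * h * n)%N `<=` ideal_pow [set` P] n.
Proof.
move=> h0 mulP; have sp1 m : (0 < m)%N -> symbolic_power P m `<=` [set` P].
  move=> m0 x; rewrite symbolic_powerE => -[u uP Pux].
  have := ideal_pow1 (prime_ideal P) (ideal_powS m0 Pux).
  by rewrite /= prime_idealrM (negPf uP).
(* Exponent 1 is treated apart: peeling there would leave exponent 0, which is not of the form
   [b.+1]. *)
elim=> // -[_|n IHn].
  move=> x; rewrite muln1 => /sp1 Px; rewrite -[x]mulr1; apply: ideal_mulM => //.
  by apply: Px; rewrite muln_gt0.
set m := (2 * h * n.+1)%N.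
have m0 : (0 < m)%N by rewrite !muln_gt0 h0.
move=> x /(@mulP 0%N m.-1); rewrite prednK // => Px.
have {}/Px : (0 + m.-1 + 2 * h < 2 * h * n.+2)%N.
  by rewrite add0n [(2 * h * n.+2)%N]mulnS addnC -addnS prednK.
by apply: ideal_mulS => //; apply: sp1.
Qed.

Import Order.TTheory Num.Theory.

(* Under the hypotheses on N and s, both integers under the absolute values are
   positive. In the last clause, 0 < h excludes minimal primes, for which
   2 * h * n = 0 and the 0-th symbolic power is the unit ideal. *)
Theorem theorem4p4 (k : fieldType) (p : nat) (chark : p \in [pchar k])
    (R : comAlgType k) (P : prime_idealr R) (h : nat)
    (k_F_finite : F_finite chark)
    (R_eft : ess_finite_type R)
    (R_F_regular : strongly_F_regular (alg_pchar R chark))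
    (D2_F_split : diagonal_cartier2_F_split (alg_pchar R chark))
    (P_height : has_height P h) :
  (forall (RR : realType) (N : nat) (s : RR),
      (2 * h < N)%N ->
      h%:R / N%:R < s < 1 - h%:R / N%:R ->
      symbolic_power P N `<=`
        ideal_mul
          (symbolic_power P `|Num.ceil (N%:R * s) - h%:Z|%N)
          (symbolic_power P `|Num.ceil (N%:R * (1 - s)) - h%:Z|%N)) /\
  ((0 < h)%N -> forall n : nat, (1 <= n)%N ->
      symbolic_power P (2 * h * n)%N `<=` ideal_pow [set` P] n).
Proof.
have [_ _ noeth _] := R_F_regular.
have [e [psi [[psi2 psi2P] [e0 psi1]]]] := D2_F_split.
have p1 : (1 < p)%N by have /andP[/prime_gt1] := chark.
have mulP a b N : (a + b + 2 * h < N)%N -> symbolic_power P N `<=`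
    ideal_mul (symbolic_power P a.+1) (symbolic_power P b.+1).
  (* Linearity on the Frobenius pushforward unfolds to the inverse-linearity required, with
     [q = p ^ e]. *)
  apply: (@symbolic_power_mul k R (p ^ e) psi psi2) => //.
  - by rewrite -(expn0 p) ltn_exp2l.
  - by move=> r x; apply: (linearZ_LR psi r x).
  - by move=> x y; apply: (linearD psi2 x y).
  - by move=> r x; apply: (linearZ_LR psi2 r x).
split; last by move=> h0 n _; apply: symbolic_power_double h0 mulP n.
move=> RR N s hN /andP[hs sh].
have N0 : (0 : RR) < N%:R by rewrite ltr0n; apply: leq_ltn_trans hN.
set x := N%:R * s; have hx : h%:R < x by rewrite /x -ltr_pdivrMl // mulrC.
rewrite mulrBr mulr1 -/x.
have xh : h%:R < N%:R - x.
  rewrite ltrBrDl -ltrBrDr /x -ltr_pdivlMl // mulrBr mulVf ?gt_eqF //.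
  by rewrite mulrC.
(* As [Num.ceil y] exceeds [h], the exponent is a successor [a.+1], and [Num.ceil y - 1 < y] bounds
   [a + h]. For the two arguments, with sum [N], these strict bounds add up to
   [a + b + 2 * h < N]. *)
have ceil_gt (y : RR) : h%:R < y -> exists2 a : nat,
    `|Num.ceil y - h%:Z|%N = a.+1 & (a + h)%:R < y.
  move=> hy; have hc : (h%:Z < Num.ceil y).
    by rewrite -(ltr_int RR); apply: lt_le_trans hy (ceil_ge y).
  exists (absz (Num.ceil y - h%:Z - 1)%R); first by lia.
  apply: le_lt_trans (ceilB1_lt y); rewrite pmulrn ler_int PoszD gez0_abs; last by lia.
  by rewrite addrAC subrK.
have [[a -> ax] [b -> bx]] := conj (ceil_gt _ hx) (ceil_gt _ xh).
apply: mulP; rewrite -(ltr_nat RR).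
have := ltrD ax bx; rewrite -natrD addrC subrK.
by rewrite (_ : a + h + (b + h) = a + b + 2 * h)%N //; lia.
Qed.
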